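(* Let $n\in\omega\setminus\{0\}$. The duality on the variety $\mathcal V_n=\mathsf{HSP}(\mathbf J_n)=\mathsf{ISP}(\{\mathbf M_0,\dots,\mathbf M_n\})$ yielded by the multi-sorted alter ego $$\mathbb M_n=\langle M_0\,\dot\cup\,M_1\,\dot\cup\cdots\dot\cup\,M_n;\ \mathcal G_{(n)},\mathcal S_{(n)},\mathscr T\rangle$$ is optimal; that is, none of the operations in $\mathcal G_{(n)}=\{g_k\mid k\in\{1,\dots,n\}\}$ and none of the relations in $\mathcal S_{(n)}=\{\leqslant^k\ \mid k\in\{0,\dots,n\}\}\cup\{\leqslant^{jk}\ \mid j,k\in\{1,\dots,n\},\ j<k\}$ can be removed from the alter ego $\mathbb M_n$ without destroying the duality.
   Context: **The algebra $\mathbf J_n$** ($n\in\omega$). $J_n=\{\top,\bot,f_0,\dots,f_n,t_0,\dots,t_n\}$ ($2n+4$ distinct elements). Knowledge order $\leqslant_k$: $\bot$ is least, $\top$ is greatest, $f_n<_k\cdots<_k f_0$, $t_n<_k\cdots<_k t_0$, each $f_i$ incomparable to each $t_j$. Truth order $\leqslant_t$: $f_0<_t\cdots<_t f_n<_t x<_t t_n<_t\cdots<_t t_0$ for both $x\in\{\top,\bot\}$, with $\top,\bot$ incomparable. $\otimes,\oplus$ are meet and join for $\leqslant_k$, $\wedge,\vee$ are meet and join for $\leqslant_t$; $\neg\top=\top$, $\neg\bot=\bot$, $\neg f_m=t_m$, $\neg t_m=f_m$. $\mathbf J_n=\langle J_n;\otimes,\oplus,\wedge,\vee,\neg,\top,f_0,\dots,f_n,t_0,\dots,t_n,\bot\rangle$,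 every element being named by a constant. **The algebras $\mathbf M_k$** (in the signature of $\mathbf J_n$). $\mathbf M_0$ has universe $\{\top,f,t,\bot\}$; its operations $\otimes,\oplus,\wedge,\vee,\neg$ and constants $\top,\bot$ are those of $\mathbf J_0$ with $f_0,t_0$ renamed $f,t$; all constants $f_0,\dots,f_n$ take the value $f$ and all constants $t_0,\dots,t_n$ take the value $t$. For $k\in\{1,\dots,n\}$, $\mathbf M_k$ has universe $\{\top,\mathbf 0,f,\mathbf 1,t,\bot\}$; its operations $\otimes,\oplus,\wedge,\vee,\neg$ and constants $\top,\bot$ are those of $\mathbf J_1$ with $f_0,f_1,t_0,t_1$ renamed $\mathbf 0,f,\mathbf 1,t$ respectively; the constants $f_0,\dots,f_{k-1}$ take the value $\mathbf 0$, $f_k,\dots,f_n$ the value $f$, $t_0,\dots,t_{k-1}$ the value $\mathbf 1$, and $t_k,\dots,t_n$ the value $t$. The sorts $M_0,\dots,M_n$ are regarded as disjoint. **Relations and maps.** - $\leqslant^0=(M_0\times\{\top\})\cup(\{\bot\}\times M_0)\cup\{(f,f),(t,t)\}$ on $M_0$. - For $k\in\{1,\dots,n\}$, $\leqslant^k=\{(\top,\top),(\bot,\bot),(f,f),(f,\mathbf 0),(\mathbf 0,\mathbf 0),(t,t),(t,\mathbf 1),(\mathbf 1,\mathbf 1)\}$ on $M_k$. - For $1\leqslant j<k\leqslant n$, $\leqslant^{jk}$ is the same set of pairs, regarded as a relation from $M_j$ to $M_k$ (a subset of $M_j\times M_k$). - $g_k:\mathbf M_k\to\mathbf M_0$ is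 the homomorphism with $f,\mathbf 0\mapsto f$; $t,\mathbf 1\mapsto t$; $\top\mapsto\top$; $\bot\mapsto\bot$. **Multi-sorted dualities.** For $\mathbf A\in\mathcal V_n$ put $\mathrm D(\mathbf A)=\mathcal V_n(\mathbf A,\mathbf M_0)\,\dot\cup\cdots\dot\cup\,\mathcal V_n(\mathbf A,\mathbf M_n)$ (homomorphism sets), topologised as a closed subspace of $M_0^A\,\dot\cup\cdots\dot\cup\,M_n^A$ (the $M_k$ discrete), with operations and relations pointwise: $g_k$ sends $x\in\mathcal V_n(\mathbf A,\mathbf M_k)$ to $g_k\circ x$, and $(x,y)$ belongs to the lift of a relation $R\subseteq M_j\times M_k$ iff $(x(a),y(a))\in R$ for all $a\in A$. An alter ego $\langle M_0\dot\cup\cdots\dot\cup M_n;\mathcal G,\mathcal R,\mathscr T\rangle$ ($\mathcal G$ a set of homomorphisms between the sorts, $\mathcal R$ a set of non-empty subuniverses of products $\mathbf M_j\times\mathbf M_k$, $\mathscr T$ discrete) *yields a duality* on $\mathcal V_n$ if, for each $\mathbf A\in\mathcal V_n$, every continuous sort-preserving map $\gamma:\mathrm D(\mathbf A)\to M_0\dot\cup\cdots\dot\cup M_n$ that preserves the operations in $\mathcal G$ and the relations in $\mathcal R$ is an evaluation $x\mapsto x(a)$ for some $a\in A$. *)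

(* Defs.v *)
From HB Require Import structures.
From mathcomp Require Import all_boot all_order.
From mathcomp Require Import all_classical all_reals all_analysis.

Set Implicit Arguments.
Unset Strict Implicit.
Unset Printing Implicit Defensive.

Import Order.TTheory.

Local Open Scope classical_set_scope.

Record algebra (n : nat) := Algebra {
  carrier :> Type;
  otimes : carrier -> carrier -> carrier;
  oplus : carrier -> carrier -> carrier;
  wedge : carrier -> carrier -> carrier;
  vee : carrier -> carrier -> carrier;
  neg : carrier -> carrier;
  ctop : carrier;
  cf : 'I_n.+1 -> carrier;
  ct : 'I_n.+1 -> carrier;
  cbot : carrier }.

Arguments ctop {n} _.
Arguments cf {n} _ _.
Arguments ct {n} _ _.
Arguments cbot {n} _.

Record is_hom n (A B : algebra n) (h : A -> B) : Prop := IsHom {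
  hom_otimes : forall a b, h (otimes a b) = otimes (h a) (h b);
  hom_oplus : forall a b, h (oplus a b) = oplus (h a) (h b);
  hom_wedge : forall a b, h (wedge a b) = wedge (h a) (h b);
  hom_vee : forall a b, h (vee a b) = vee (h a) (h b);
  hom_neg : forall a, h (neg a) = neg (h a);
  hom_top : h (ctop A) = ctop B;
  hom_f : forall i, h (cf A i) = cf B i;
  hom_t : forall i, h (ct A i) = ct B i;
  hom_bot : h (cbot A) = cbot B }.

Record is_subuniverse n (A : algebra n) (S : set A) : Prop := IsSubuniverse {
  sub_otimes : forall a b, S a -> S b -> S (otimes a b);
  sub_oplus : forall a b, S a -> S b -> S (oplus a b);
  sub_wedge : forall a b, S a -> S b -> S (wedge a b);
  sub_vee : forall a b, S a -> S b -> S (vee a b);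
  sub_neg : forall a, S a -> S (neg a);
  sub_top : S (ctop A);
  sub_f : forall i, S (cf A i);
  sub_t : forall i, S (ct A i);
  sub_bot : S (cbot A) }.

Definition prod_algebra n (I : Type) (B : I -> algebra n) : algebra n :=
  @Algebra n (forall i, B i)
    (fun a b i => otimes (a i) (b i)) (fun a b i => oplus (a i) (b i))
    (fun a b i => wedge (a i) (b i)) (fun a b i => vee (a i) (b i))
    (fun a i => neg (a i))
    (fun i => ctop (B i)) (fun c i => cf (B i) c) (fun c i => ct (B i) c)
    (fun i => cbot (B i)).

Definition pair_algebra n (A B : algebra n) : algebra n :=
  @Algebra n (A * B)%type
    (fun a b => (otimes a.1 b.1, otimes a.2 b.2))
    (fun a b => (oplus a.1 b.1, oplus a.2 b.2))
    (fun a b => (wedge a.1 b.1, wedge a.2 b.2))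
    (fun a b => (vee a.1 b.1, vee a.2 b.2))
    (fun a => (neg a.1, neg a.2))
    (ctop A, ctop B) (fun i => (cf A i, cf B i)) (fun i => (ct A i, ct B i))
    (cbot A, cbot B).

(** Classes of algebras are plain predicates, as [set (algebra n)] would be
    universe-inconsistent with algebras having carriers built on ordinals.

    [opH K] and [opS K] are closed under isomorphism by construction, so the
    operator I is absorbed in [HSP] and [ISP]. *)

Definition aclass (n : nat) := algebra n -> Prop.

Definition opH n (K : aclass n) : aclass n := fun A =>
  exists2 B, K B &
    exists h : B -> A, is_hom h /\ (forall a, exists b, h b = a).

Definition opS n (K : aclass n) : aclass n := fun A =>
  exists2 B, K B & exists h : A -> B, is_hom h /\ injective h.

Definition opP n (K : aclass n) : aclass n := fun A =>
  exists (I : Type) (B : I -> algebra n),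
    (forall i, K (B i)) /\ A = prod_algebra B.

Definition HSP n (K : aclass n) : aclass n := opH (opS (opP K)).
Definition ISP n (K : aclass n) : aclass n := opS (opP K).

Inductive jelt (m : nat) : Type :=
  | Top | Bot | Jf of 'I_m.+1 | Jt of 'I_m.+1.

Arguments Top {m}.
Arguments Bot {m}.
Arguments Jf {m} _.
Arguments Jt {m} _.

Section JEncoding.
Variable m : nat.

Definition jelt_code (x : jelt m) : bool * option 'I_m.+1 :=
  match x with
  | Top => (true, None)
  | Bot => (false, None)
  | Jf i => (false, Some i)
  | Jt i => (true, Some i)
  end.

Definition jelt_decode (c : bool * option 'I_m.+1) : jelt m :=
  match c with
  | (true, None) => Top
  | (false, None) => Bot
  | (false, Some i) => Jf i
  | (true, Some i) => Jt i
  end.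

Lemma jelt_codeK : cancel jelt_code jelt_decode.
Proof. by case. Qed.

End JEncoding.

HB.instance Definition _ m := Finite.copy (jelt m) (can_type (@jelt_codeK m)).
HB.instance Definition _ m := hasNbhs.Build (jelt m) principal_filter.
HB.instance Definition _ m := Discrete_ofNbhs.Build (jelt m) erefl.

Section JOperations.
Variable m : nat.
Implicit Types x y z : jelt m.

Definition kle x y : bool :=
  match x, y with
  | Bot, _ | _, Top => true
  | Jf i, Jf j | Jt i, Jt j => (j <= i)%N
  | _, _ => false
  end.

Definition tle x y : bool :=
  match x, y with
  | Jf i, Jf j => (i <= j)%N
  | Jt i, Jt j => (j <= i)%N
  | Jf _, _ | _, Jt _ => true
  | Top, Top | Bot, Bot => true
  | _, _ => false
  end.

Definition kmeet x y : jelt m :=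
  match x, y with
  | Top, z | z, Top => z
  | Jf i, Jf j => Jf (Order.max i j)
  | Jt i, Jt j => Jt (Order.max i j)
  | _, _ => Bot
  end.

Definition kjoin x y : jelt m :=
  match x, y with
  | Bot, z | z, Bot => z
  | Jf i, Jf j => Jf (Order.min i j)
  | Jt i, Jt j => Jt (Order.min i j)
  | _, _ => Top
  end.

Definition tmeet x y : jelt m :=
  match x, y with
  | Jf i, Jf j => Jf (Order.min i j)
  | Jf i, _ | _, Jf i => Jf i
  | Jt i, Jt j => Jt (Order.max i j)
  | Jt _, z | z, Jt _ => z
  | Top, Top => Top
  | Bot, Bot => Bot
  | Top, Bot | Bot, Top => Jf ord_max
  end.

Definition tjoin x y : jelt m :=
  match x, y with
  | Jt i, Jt j => Jt (Order.min i j)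
  | Jt i, _ | _, Jt i => Jt i
  | Jf i, Jf j => Jf (Order.max i j)
  | Jf _, z | z, Jf _ => z
  | Top, Top => Top
  | Bot, Bot => Bot
  | Top, Bot | Bot, Top => Jt ord_max
  end.

Definition jneg x : jelt m :=
  match x with
  | Top => Top
  | Bot => Bot
  | Jf i => Jt i
  | Jt i => Jf i
  end.

Lemma kmeetP x y z : kle z (kmeet x y) = kle z x && kle z y.
Proof.
case: x y z => [||i|i] [||j|j] [||l|l] //=; rewrite ?andbT ?andbF //.
- exact: (ge_max l i j).
- exact: (ge_max l i j).
Qed.

Lemma kjoinP x y z : kle (kjoin x y) z = kle x z && kle y z.
Proof.
case: x y z => [||i|i] [||j|j] [||l|l] //=; rewrite ?andbT ?andbF //.
- exact: (le_min l i j).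
- exact: (le_min l i j).
Qed.

Lemma tmeetP x y z : tle z (tmeet x y) = tle z x && tle z y.
Proof.
case: x y z => [||i|i] [||j|j] [||l|l] //=; rewrite ?andbT ?andbF ?leq_ord //.
- exact: (le_min l i j).
- exact: (ge_max l i j).
Qed.

Lemma tjoinP x y z : tle (tjoin x y) z = tle x z && tle y z.
Proof.
case: x y z => [||i|i] [||j|j] [||l|l] //=; rewrite ?andbT ?andbF ?leq_ord //.
- exact: (ge_max l i j).
- exact: (le_min l i j).
Qed.

Lemma kle_anti x y : kle x y -> kle y x -> x = y.
Proof.
by case: x y => [||i|i] [||j|j] //= ij ji; congr (_ _); apply/val_inj/anti_leq;
  rewrite ij ji.
Qed.

Lemma tle_anti x y : tle x y -> tle y x -> x = y.
Proof.
by case: x y => [||i|i] [||j|j] //= ij ji; congr (_ _); apply/val_inj/anti_leq;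
  rewrite ij ji.
Qed.

End JOperations.

(** The operations of J_m, in the signature of J_n, the constants f_i and t_i
    being interpreted by the elements of index [c i]. *)
Definition jalg n m (c : 'I_n.+1 -> 'I_m.+1) : algebra n :=
  @Algebra n (jelt m) (@kmeet m) (@kjoin m) (@tmeet m) (@tjoin m) (@jneg m)
    Top (fun i => Jf (c i)) (fun i => Jt (c i)) Bot.

Definition J n : algebra n := @jalg n n id.

(** [Msort 0] is the universe of J_0 and [Msort k], for k > 0, that of J_1.
    With m = 0 or m = 1 as the case may be, the bold zero of M_k (k > 0) is
    [Jf ord0], its f is [Jf ord_max], the bold one is [Jt ord0] and t is
    [Jt ord_max]; in M_0, where ord0 = ord_max, both name f (resp. t). *)

Definition Msort (k : nat) := jelt (0 < k)%N.

Definition M n (k : 'I_n.+1) : algebra n :=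
  @jalg n (0 < k)%N (fun i => if (i < k)%N then ord0 else ord_max).

Definition gmap m (x : jelt m) : jelt 0 :=
  match x with
  | Top => Top
  | Bot => Bot
  | Jf _ => Jf ord0
  | Jt _ => Jt ord0
  end.

Definition le_four : set (jelt 0 * jelt 0) :=
  [set: jelt 0] `*` [set Top] `|` [set Bot] `*` [set: jelt 0]
  `|` [set (Jf ord0, Jf ord0); (Jt ord0, Jt ord0)].

(** The common set of pairs underlying both the relations on a single M_k and
    those from M_j to M_k (j < k); used at m = p = 1 only. *)
Definition le_six m p : set (jelt m * jelt p) :=
  [set (Top, Top); (Bot, Bot);
       (Jf ord_max, Jf ord_max); (Jf ord_max, Jf ord0); (Jf ord0, Jf ord0);
       (Jt ord_max, Jt ord_max); (Jt ord_max, Jt ord0); (Jt ord0, Jt ord0)].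

Definition V_ n : aclass n := HSP (fun B => B = J n).
Arguments V_ : clear implicits.

Record msop n := MsOp {
  osrc : 'I_n.+1;
  otgt : 'I_n.+1;
  ofun : Msort osrc -> Msort otgt }.

Record msrel n := MsRel {
  rsrc : 'I_n.+1;
  rtgt : 'I_n.+1;
  rset : set (Msort rsrc * Msort rtgt) }.

Section Duality.
Variables (n : nat) (A : algebra n).

(** M_0^A + ... + M_n^A, each power carrying the product topology. *)
Definition mspower := {k : 'I_n.+1 & {ptws A -> Msort k}}.

Definition dualset : set mspower :=
  [set p | @is_hom n A (M (projT1 p)) (projT2 p)].

(** A sort-preserving map from D(A) is given as a family [gamma]; its values
    outside the hom-sets are irrelevant. *)
Variable gamma : forall k : 'I_n.+1, (A -> Msort k) -> Msort k.

Definition msmap (p : mspower) : {k : 'I_n.+1 & Msort k} :=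
  existT (fun k : 'I_n.+1 => Msort k) (projT1 p) (gamma (projT2 p)).

Definition preserves_op (o : msop n) : Prop :=
  forall x : A -> Msort (osrc o), @is_hom n A (M (osrc o)) x ->
    gamma (fun a => ofun (x a)) = ofun (gamma x).

Definition preserves_rel (r : msrel n) : Prop :=
  forall (x : A -> Msort (rsrc r)) (y : A -> Msort (rtgt r)),
    @is_hom n A (M (rsrc r)) x -> @is_hom n A (M (rtgt r)) y ->
    (forall a, rset (x a, y a)) -> rset (gamma x, gamma y).

Definition is_evaluation : Prop :=
  exists a : A, forall (k : 'I_n.+1) (x : A -> Msort k),
    @is_hom n A (M k) x -> gamma x = x a.

End Duality.

Definition yields_duality n (V : aclass n)
    (G : set (msop n)) (R : set (msrel n)) : Prop :=
  forall A : algebra n, V A ->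
  forall gamma : (forall k : 'I_n.+1, (A -> Msort k) -> Msort k),
    {within dualset (A := A), continuous (msmap gamma)} ->
    (forall o, G o -> preserves_op gamma o) ->
    (forall r, R r -> preserves_rel gamma r) ->
    is_evaluation gamma.

Definition optimal_duality n (V : aclass n)
    (G : set (msop n)) (R : set (msrel n)) : Prop :=
  [/\ yields_duality V G R,
      forall o, G o -> ~ yields_duality V (G `\ o) R
    & forall r, R r -> ~ yields_duality V G (R `\ r)].

Definition g_op n (k : 'I_n.+1) : msop n :=
  @MsOp n k ord0 (@gmap (0 < k)%N).

Definition le_zero n : msrel n := @MsRel n ord0 ord0 le_four.

Definition le_sort n (k : 'I_n.+1) : msrel n :=
  @MsRel n k k (@le_six (0 < k)%N (0 < k)%N).

Definition le_sorts n (j k : 'I_n.+1) : msrel n :=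
  @MsRel n j k (@le_six (0 < j)%N (0 < k)%N).

Definition G_ n : set (msop n) :=
  [set g_op k | k in [set k : 'I_n.+1 | (0 < k)%N]].

Definition S_ n : set (msrel n) :=
  [set le_zero n]
  `|` [set le_sort k | k in [set k : 'I_n.+1 | (0 < k)%N]]
  `|` [set r | exists j k : 'I_n.+1,
                 [/\ (0 < j)%N, (j < k)%N & r = le_sorts j k]].

Arguments G_ : clear implicits.
Arguments S_ : clear implicits.

(** [G_ n] and [S_ n] form an alter ego: homomorphisms between the sorts and
    non-empty subuniverses of binary products of sorts. *)

Lemma G_hom n o : G_ n o -> @is_hom n (M (osrc o)) (M (otgt o)) (@ofun n o).
Proof.
have I1 (i : 'I_1) : i = ord0 by rewrite ord1.
case=> k _ <-; split=> //=.
- by case=> [||i|i] [||j|j] //=; rewrite maxxx.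
- by case=> [||i|i] [||j|j] //=; rewrite minxx.
- by case=> [||i|i] [||j|j] //=; rewrite ?maxxx ?minxx // (I1 ord_max).
- by case=> [||i|i] [||j|j] //=; rewrite ?maxxx ?minxx // (I1 ord_max).
- by case.
- by move=> i; congr Jf; exact: esym (I1 _).
- by move=> i; congr Jt; exact: esym (I1 _).
Qed.

Definition le_six_bool m p (x : jelt m) (y : jelt p) : bool :=
  match x, y with
  | Top, Top | Bot, Bot => true
  | Jf i, Jf j | Jt i, Jt j => (j <= i)%N
  | _, _ => false
  end.

Lemma le_sixE (x y : jelt 1) : @le_six 1 1 (x, y) <-> le_six_bool x y.
Proof.
have ordE (i : 'I_2) : i = ord0 \/ i = ord_max.
  by case: i => -[|[|//]] lt_i; [left|right]; exact/val_inj.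
split; first by rewrite /le_six /=; do 7?[case]; case=> -> ->.
rewrite /le_six /=; case: x y => [||i|i] [||j|j] //=; try by move=> _; tauto.
- by case: (ordE i) (ordE j) => -> [] -> //= _; tauto.
- by case: (ordE i) (ordE j) => -> [] -> //= _; tauto.
Qed.

Lemma le_fourE (x y : jelt 0) : le_four (x, y) <-> kle x y.
Proof.
split; first by rewrite /le_four /=; move=> [[[_ ->]|[-> _]]|[[-> ->]|[-> ->]]] //; case: x.
by rewrite /le_four /=; case: x y => [||i|i] [||j|j] //= _;
  rewrite ?[i]ord1 ?[j]ord1; tauto.
Qed.

Lemma S_subuniverse n r : S_ n r ->
  @is_subuniverse n (pair_algebra (M (rsrc r)) (M (rtgt r))) (@rset n r).
Proof.
have sub0 : @is_subuniverse n
    (pair_algebra (@jalg n 0 (fun=> ord_max)) (@jalg n 0 (fun=> ord_max)))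
    le_four.
  by split=> [[a b] [c d]|[a b] [c d]|[a b] [c d]|[a b] [c d]|[a b]||i|i|] /=;
    rewrite ?le_fourE //=;
    move: a b => [||a|a] [||b|b] //=; move: c d => [||c|c] [||d|d] //=;
    rewrite ?[a]ord1 ?[b]ord1 ?[c]ord1 ?[d]ord1.
have mx (a b c d : 'I_2) : (b <= a)%N -> (d <= c)%N ->
    (Order.max b d <= Order.max a c)%N.
  exact: (@le_max2 _ 'I_2 b d a c).
have mn (a b c d : 'I_2) : (b <= a)%N -> (d <= c)%N ->
    (Order.min b d <= Order.min a c)%N.
  exact: (@le_min2 _ 'I_2 b d a c).
have sub1 (j k : 'I_n.+1) : (j <= k)%N -> @is_subuniverse n
    (pair_algebra (@jalg n 1 (fun i => if (i < j)%N then ord0 else ord_max))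
       (@jalg n 1 (fun i => if (i < k)%N then ord0 else ord_max)))
    (@le_six 1 1).
  move=> jk.
  have cst (i : 'I_n.+1) : ((if (i < k)%N then ord0 else ord_max : 'I_2)
      <= (if (i < j)%N then ord0 else ord_max : 'I_2))%N.
    by case: (ltnP i j) => [/leq_trans->|] //; rewrite leq_ord.
  split=> [[a b] [c d]|[a b] [c d]|[a b] [c d]|[a b] [c d]|[a b]||i|i|] /=;
    rewrite ?le_sixE //=;
    move: a b => [||a|a] [||b|b] //=; move: c d => [||c|c] [||d|d] //=;
    by [exact: mx | exact: mn].
case=> [[->|[k k_gt0 <-]]|[j [k [j_gt0 jk ->]]]] /=.
- exact: sub0.
- by move: k k_gt0 => [[//|k] lt_k] _; exact: (sub1 (Ordinal lt_k)).
- move: j k j_gt0 jk => [[//|j] lt_j] [[//|k] lt_k] _ jk.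
  exact/(sub1 (Ordinal lt_j) (Ordinal lt_k))/ltnW.
Qed.

Lemma S_neq0 n r : S_ n r -> @rset n r !=set0.
Proof.
case=> [[->|[k _ <-]]|[j [k [_ _ ->]]]]; exists (Top, Top).
- by left; left.
- by do 7!left.
- by do 7!left.
Qed.

(* Main.v *)
(** Membership in the variety (Jonsson's argument): for A = h(B), with B a
    subalgebra of J_n^I, a prime filter F of the distributive lattice
    (A; wedge, vee) determines an ultrafilter U on I such that F pulled back to
    B is the inverse image of a prime filter Q of J_n under the U-limit of the
    coordinate maps. The position of Q in the chains of the f_i and t_i gives a
    k such that B -> J_n -> M_k factors through A.

    Duality: as the sorts have a majority term, it is enough to interpolate
    gamma on two homomorphisms x, y at a time (Baker-Pixley, made uniform by
    the compactness of D(A)), that is, to show that (gamma x, gamma y) lies in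
    the subuniverse R of M_j x M_k that is the image of (x, y). The few
    subuniverses of M_j x M_k are intersections of the relations of the alter
    ego, their converses and their inverse images under the g_k.

    Optimality: the test algebra for a relation is the relation itself, and
    for g_k it is M_k. *)
From Stdlib Require List.
Require Import Defs.
From mathcomp Require Import all_boot.
From mathcomp Require Import all_order all_classical all_reals all_analysis.

Set Implicit Arguments.
Unset Strict Implicit.
Unset Printing Implicit Defensive.

Import Order.TTheory.

Local Open Scope classical_set_scope.

(** * Subuniverses of products of two sorts *)

Section PairClosure.
Variables m p : nat.
Implicit Types (z w : jelt m * jelt p) (s : seq (jelt m * jelt p)).

Definition pair_op2 (f : jelt m -> jelt m -> jelt m)
    (g : jelt p -> jelt p -> jelt p) s :=
  [seq (f z.1 w.1, g z.2 w.2) | z <- s, w <- s].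

(** The generic equality of [jelt] is too slow for evaluation. *)
Definition jeqb q (x y : jelt q) : bool :=
  match x, y with
  | Top, Top | Bot, Bot => true
  | Jf i, Jf j | Jt i, Jt j => eqn i j
  | _, _ => false
  end.

Definition pair_mem z s :=
  has (fun w => if jeqb z.1 w.1 then jeqb z.2 w.2 else false) s.

Definition pair_add s z := if pair_mem z s then s else z :: s.

Lemma pair_memP z s : pair_mem z s -> z \in s.
Proof.
have jeqbP q (x y : jelt q) : jeqb x y -> x = y.
  by case: x y => [||i|i] [||j|j] //= /eqnP ij; congr (_ _); exact: val_inj.
case: z => x y /hasP[[x' y'] /= ins]; case: ifP => // /jeqbP -> /jeqbP ->.
exact: ins.
Qed.

Definition closure_step s : seq (jelt m * jelt p) :=
  foldl pair_add s ([seq (jneg z.1, jneg z.2) | z <- s]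
    ++ pair_op2 (@kmeet m) (@kmeet p) s ++ pair_op2 (@kjoin m) (@kjoin p) s
    ++ pair_op2 (@tmeet m) (@tmeet p) s ++ pair_op2 (@tjoin m) (@tjoin p) s).

(** [N] is fuel. For every [N] the result stays inside each subuniverse containing [s], which is all
    that soundness asks; that it is large enough is checked by evaluation in each case. *)
Fixpoint pair_closure N s :=
  if N is N'.+1 then
    let s' := closure_step s in
    if size s' == size s then s else pair_closure N' s'
  else s.

Lemma pair_closure_sub n (c : 'I_n.+1 -> 'I_m.+1) (d : 'I_n.+1 -> 'I_p.+1)
    (R : set (jelt m * jelt p)) N s :
  @is_subuniverse n (pair_algebra (jalg c) (jalg d)) R ->
  {in s, forall z, R z} -> {in pair_closure N s, forall z, R z}.
Proof.
move=> subR; elim: N s => //= N IH s sR; case: ifP => // _; apply: IH => z.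
have addR t u : {in t, forall z, R z} -> {in u, forall z, R z} ->
    {in foldl pair_add t u, forall z, R z}.
  elim: u t => //= y u IHu t tR uR; apply: IHu => [w|w wu]; last first.
    by apply: uR; rewrite in_cons wu orbT.
  rewrite /pair_add; case: ifP => _; first exact: tR.
  by rewrite in_cons => /orP[/eqP ->|/tR //]; apply: uR; exact: mem_head.
apply: addR z => // z.
rewrite !mem_cat => /orP[/mapP[w /sR Rw ->]|]; first exact: (sub_neg subR Rw).
have op2 f g : (forall a b, R a -> R b -> R (f a.1 b.1, g a.2 b.2)) ->
    z \in pair_op2 f g s -> R z.
  by move=> fg /allpairsP[[a b] /= [/sR Ra /sR Rb ->]]; exact: fg.
case/or4P; apply: op2 => a b Ra Rb.
- exact: (sub_otimes subR Ra Rb).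
- exact: (sub_oplus subR Ra Rb).
- exact: (sub_wedge subR Ra Rb).
- exact: (sub_vee subR Ra Rb).
Qed.

(** The pairs [(T, K)] in [Ts] are meant to satisfy: a subuniverse containing
    the constants [s] and not included in [T] contains [K]. *)
Definition dichotomies (E s : seq (jelt m * jelt p))
    (Ts : seq (pred (jelt m * jelt p) * pred (jelt m * jelt p))) :=
  all (fun TK => all (fun r => if TK.1 r then true else
    let C := pair_closure (size E) (r :: s) in
    all (fun z => if TK.2 z then pair_mem z C else true) E) E) Ts &&
  all (fun z => pair_mem z (pair_closure (size E)
    (s ++ [seq w <- E | has (fun TK => ~~ TK.1 z && TK.2 w) Ts]))) E.

(** If [T] fails at [z] then [R] is not included in [T], so the first check puts all of [K] inside
    [R]. By the second check these [K], together with the constants, generate [z]. Hence [R] is the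
    intersection of the listed [T] that include it. *)
Lemma dichotomies_separate n (c : 'I_n.+1 -> 'I_m.+1) (d : 'I_n.+1 -> 'I_p.+1)
    (R : set (jelt m * jelt p)) E s Ts :
  @is_subuniverse n (pair_algebra (jalg c) (jalg d)) R ->
  (forall z, z \in E) -> {in s, forall z, R z} -> dichotomies E s Ts ->
  forall z,
    (forall T K, List.In (T, K) Ts -> (forall r, R r -> T r) -> T z) -> R z.
Proof.
move=> subR inE sR /andP[dichT cover] z Tz.
have /allP/(_ z (inE z))/pair_memP := cover.
apply: (pair_closure_sub subR) => w.
rewrite mem_cat => /orP[/sR //|]; rewrite mem_filter => /andP[hasT _].
elim: Ts dichT {cover} Tz hasT => //= -[T K] Ts IH /andP[allT allTs] Tz.
case/orP => /= [/andP[nTz Kw]|]; last first.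
  by apply: IH => // T' K' inT; apply: (Tz T' K'); right.
have [Rsub|] := pselect (forall r, R r -> T r).
  by move: nTz; rewrite (Tz T K (or_introl erefl) Rsub).
move=> /existsNP[r /not_implyP[Rr /negP nTr]].
move: allT => /allP/(_ r (inE r)); rewrite /= (negbTE nTr) /=.
move=> /allP/(_ w (inE w)); rewrite Kw => /pair_memP.
by apply: (pair_closure_sub subR) => v; rewrite in_cons => /orP[/eqP ->|/sR].
Qed.

End PairClosure.

(** * Classification of the subuniverses of M_j x M_k by computation *)

Lemma ord_boolE (b : bool) (i : 'I_b.+1) : i = ord0 \/ i = ord_max.
Proof.
case: i => i lt_i; have [i0|i_gt0] := posnP i; [left | right];
  apply/val_inj => //=.
by case: b lt_i => /=; case: i i_gt0 => [|[|]].
Qed.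

Definition elements (b : bool) : seq (jelt b) :=
  [:: Top; Bot; Jf ord0; Jf ord_max; Jt ord0; Jt ord_max].

Definition pairs (b c : bool) : seq (jelt b * jelt c) :=
  [seq (x, y) | x <- elements b, y <- elements c].

Lemma mem_pairs (b c : bool) (z : jelt b * jelt c) : z \in pairs b c.
Proof.
have mem_elements (d : bool) (x : jelt d) : x \in elements d.
  by rewrite !inE; case: x => [||i|i] //;
    case: (ord_boolE i) => ->; rewrite eqxx ?orbT.
by case: z => x y; apply: allpairs_f; exact: mem_elements.
Qed.

Section PairRelations.
Variables m p : nat.
Implicit Types z : jelt m * jelt p.

(** Boolean forms, fit for evaluation, of the inverse images under the g_k of [le_four], its
    converse and equality, then of [le_six] and its converse. *)
Definition gle z := kle (gmap z.1) (gmap z.2).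
Definition gge z := kle (gmap z.2) (gmap z.1).
Definition geq z := gmap z.1 == gmap z.2.
Definition sle z := le_six_bool z.1 z.2.
Definition sge z := le_six_bool z.2 z.1.

End PairRelations.

(** The pairs of values of the constants of index 0 and n. *)
Definition extreme_constants (b c : bool) : seq (jelt b * jelt c) :=
  [:: (Top, Top); (Bot, Bot); (Jf ord_max, Jf ord_max); (Jf ord0, Jf ord0);
      (Jt ord_max, Jt ord_max); (Jt ord0, Jt ord0)].

Definition g_dichotomies m p :=
  [:: (@gle m p, @gge m p); (@gge m p, @gle m p)].

Definition s_dichotomies :=
  [:: (@sle 1 1, @sge 1 1); (@sge 1 1, @sle 1 1)].

Lemma dichotomies_zero (b : bool) :
  dichotomies (pairs false b) (extreme_constants false b)
    (g_dichotomies false b).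
Proof. by case: b; vm_compute. Qed.

Lemma dichotomies_same : @dichotomies true true (pairs true true)
  (extreme_constants true true) (g_dichotomies 1 1 ++ s_dichotomies).
Proof. by vm_compute. Qed.

(** If [j < k] then the constants of index [j] contribute two more pairs, so
    that the converse of [le_six] is out of reach. *)
Lemma dichotomies_lt : @dichotomies true true (pairs true true)
  ((Jf ord_max, Jf ord0) :: (Jt ord_max, Jt ord0)
    :: extreme_constants true true)
  ((@sle 1 1, @geq 1 1) :: g_dichotomies 1 1).
Proof. by vm_compute. Qed.

(** * Composition, pairing and images of homomorphisms *)

Lemma hom_comp n (A B C : algebra n) (h : A -> B) (g : B -> C) :
  is_hom h -> is_hom g -> is_hom (fun a => g (h a)).
Proof.
move=> H G; split=> *.
- by rewrite (hom_otimes H) (hom_otimes G).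
- by rewrite (hom_oplus H) (hom_oplus G).
- by rewrite (hom_wedge H) (hom_wedge G).
- by rewrite (hom_vee H) (hom_vee G).
- by rewrite (hom_neg H) (hom_neg G).
- by rewrite (hom_top H) (hom_top G).
- by rewrite (hom_f H) (hom_f G).
- by rewrite (hom_t H) (hom_t G).
- by rewrite (hom_bot H) (hom_bot G).
Qed.

Lemma hom_pair n (A B C : algebra n) (x : A -> B) (y : A -> C) :
  is_hom x -> is_hom y -> @is_hom n A (pair_algebra B C) (fun a => (x a, y a)).
Proof.
move=> X Y; split=> * /=; congr (_, _);
  by [apply: hom_otimes | apply: hom_oplus | apply: hom_wedge
     | apply: hom_vee | apply: hom_neg | apply: hom_top | apply: hom_f
     | apply: hom_t | apply: hom_bot].
Qed.

Lemma range_subuniverse n (A B : algebra n) (h : A -> B) :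
  is_hom h -> is_subuniverse (range h).
Proof.
move=> H; split=> [_ _ [a _ <-] [b _ <-]|_ _ [a _ <-] [b _ <-]
  |_ _ [a _ <-] [b _ <-]|_ _ [a _ <-] [b _ <-]|_ [a _ <-]||i|i|].
- by exists (otimes a b); rewrite ?(hom_otimes H).
- by exists (oplus a b); rewrite ?(hom_oplus H).
- by exists (wedge a b); rewrite ?(hom_wedge H).
- by exists (vee a b); rewrite ?(hom_vee H).
- by exists (neg a); rewrite ?(hom_neg H).
- by exists (ctop A); rewrite ?(hom_top H).
- by exists (cf A i); rewrite ?(hom_f H).
- by exists (ct A i); rewrite ?(hom_t H).
- by exists (cbot A); rewrite ?(hom_bot H).
Qed.

Lemma sort0_or_gt0 n (k : 'I_n.+1) : k = ord0 \/ (0 < k)%N.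
Proof. by case: k => -[|k] lt_k; [left; exact: val_inj|right]. Qed.

(** * Interpolation of gamma at two homomorphisms *)

Section Interpolation.
Variables (n : nat) (A : algebra n).
Variable gamma : forall k : 'I_n.+1, (A -> Msort k) -> Msort k.
Hypothesis gammaG : forall o, @G_ n o -> preserves_op gamma o.
Hypothesis gammaS : forall r, @S_ n r -> preserves_rel gamma r.

Lemma M_f0 (k : 'I_n.+1) : cf (M k) ord0 = Jf ord0.
Proof.
rewrite /=; case: k => -[|k] lt_k //=; congr Jf; exact/val_inj.
Qed.

Lemma M_t0 (k : 'I_n.+1) : ct (M k) ord0 = Jt ord0.
Proof.
rewrite /=; case: k => -[|k] lt_k //=; congr Jt; exact/val_inj.
Qed.

Lemma M_fmax (k : 'I_n.+1) : cf (M k) ord_max = Jf ord_max.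
Proof. by rewrite /= ifF //; apply/negbTE; rewrite -leqNgt -ltnS. Qed.

Lemma M_tmax (k : 'I_n.+1) : ct (M k) ord_max = Jt ord_max.
Proof. by rewrite /= ifF //; apply/negbTE; rewrite -leqNgt -ltnS. Qed.

(** On M_0, where there is no operation g, [gmap] is the identity; so all sorts can be treated
    alike. *)
Lemma gmap_gamma (k : 'I_n.+1) (x : A -> Msort k) : @is_hom n A (M k) x ->
  @is_hom n A (M ord0) (fun a => @gmap (0 < k)%N (x a)) /\
  gamma (k := ord0) (fun a => @gmap (0 < k)%N (x a)) =
    @gmap (0 < k)%N (gamma x).
Proof.
move=> homx; have [k0|k_gt0] := sort0_or_gt0 k; last first.
  have Gk : @G_ n (g_op k) by exists k.
  have homg : @is_hom n (M k) (M ord0) (@gmap (0 < k)%N) := G_hom Gk.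
  split; last exact: (gammaG Gk homx).
  exact: (@hom_comp n A (M k) (M ord0) x _ homx homg).
subst k; have gid (z : jelt 0) : gmap z = z.
  by case: z => // i; rewrite [i]ord1.
have E : (fun a => @gmap (0 < @ord0 n)%N (x a)) = x.
  by apply/funext => a; exact: gid.
by rewrite E; split => //; exact/esym/gid.
Qed.

Lemma gamma_gle (j k : 'I_n.+1) (x : A -> Msort j) (y : A -> Msort k) :
  @is_hom n A (M j) x -> @is_hom n A (M k) y ->
  (forall a, @gle (0 < j)%N (0 < k)%N (x a, y a)) ->
  @gle (0 < j)%N (0 < k)%N (gamma x, gamma y).
Proof.
move=> /gmap_gamma[homx gx] /gmap_gamma[homy gy] xy.
rewrite /gle /= -gx -gy; apply/le_fourE.
have S0 : @S_ n (le_zero n) by left; left.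
by apply: (gammaS S0 homx homy) => a; apply/le_fourE/xy.
Qed.

Lemma gamma_sle (j k : 'I_n.+1) (x : A -> Msort j) (y : A -> Msort k) :
  (0 < j)%N -> (j <= k)%N -> @is_hom n A (M j) x -> @is_hom n A (M k) y ->
  (forall a, @sle (0 < j)%N (0 < k)%N (x a, y a)) ->
  @sle (0 < j)%N (0 < k)%N (gamma x, gamma y).
Proof.
move=> j_gt0; rewrite leq_eqVlt => /orP[/eqP/val_inj jk|jk] homx homy xy.
  subst k; have Sj : @S_ n (le_sort j) by left; right; exists j.
  (* Destructing the index makes [(0 < j)%N] compute, so that the sort becomes [jelt 1] as in
     [le_sixE]. *)
  case: j j_gt0 Sj x homx y homy xy => -[//|j] lt_j _ Sj x homx y homy xy.
  by apply/le_sixE; apply: (gammaS Sj homx homy) => a; apply/le_sixE/xy.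
have Sjk : @S_ n (le_sorts j k) by right; exists j, k.
case: k jk Sjk y homy xy => -[//|k] lt_k jk Sjk y homy xy.
case: j j_gt0 jk Sjk x homx xy => -[//|j] lt_j _ jk Sj x homx xy.
by apply/le_sixE; apply: (gammaS Sj homx homy) => a; apply/le_sixE/xy.
Qed.

Lemma gamma_g_dichotomies (j k : 'I_n.+1)
    (x : A -> Msort j) (y : A -> Msort k) T K :
  @is_hom n A (M j) x -> @is_hom n A (M k) y ->
  List.In (T, K) (g_dichotomies (0 < j)%N (0 < k)%N) ->
  (forall r, range (fun a => (x a, y a)) r -> T r) -> T (gamma x, gamma y).
Proof.
move=> homx homy + subT; have xy a : T (x a, y a) by apply: subT; exists a.
move=> inT; move: xy; case: inT => [TE|[TE|//]]; case: TE => <- _ xy.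
  exact: gamma_gle.
exact: (@gamma_gle k j y x).
Qed.

(** The image of [(x, y)] is a subuniverse, so [dichotomies_separate] leaves only this to check:
    [gamma] respects those listed [T] that include the image. *)
Lemma gamma_interp_le (j k : 'I_n.+1) (x : A -> Msort j) (y : A -> Msort k) :
  (j <= k)%N -> @is_hom n A (M j) x -> @is_hom n A (M k) y ->
  exists a, gamma x = x a /\ gamma y = y a.
Proof.
move=> jk homx homy; pose R := range (fun a => (x a, y a)).
suff [a _ [xa ya]] : R (gamma x, gamma y) by exists a; rewrite xa ya.
have subR := range_subuniverse (hom_pair homx homy).
have homR a : R (x a, y a) by exists a.
have constR : {in extreme_constants (0 < j)%N (0 < k)%N, forall z, R z}.
  move=> z; rewrite !inE.
  case/or4P=> [/eqP->|/eqP->|/eqP->|/or3P[]/eqP->].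
  - by have := homR (ctop A); rewrite (hom_top homx) (hom_top homy).
  - by have := homR (cbot A); rewrite (hom_bot homx) (hom_bot homy).
  - by have := homR (cf A ord_max); rewrite (hom_f homx) (hom_f homy) !M_fmax.
  - by have := homR (cf A ord0); rewrite (hom_f homx) (hom_f homy) !M_f0.
  - by have := homR (ct A ord_max); rewrite (hom_t homx) (hom_t homy) !M_tmax.
  - by have := homR (ct A ord0); rewrite (hom_t homx) (hom_t homy) !M_t0.
have gR := gamma_g_dichotomies homx homy.
have [j0|j_gt0] := sort0_or_gt0 j.
  subst j.
  apply: (dichotomies_separate subR (@mem_pairs false _) constR
    (dichotomies_zero _)).
  exact: gR.
have sR := gamma_sle j_gt0 jk homx homy.
(* The converse relation is available only within a single sort, by exchanging [x] and [y]. *)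
have sR' : j = k -> (forall a, @sge (0 < j)%N (0 < k)%N (x a, y a)) ->
    @sge (0 < j)%N (0 < k)%N (gamma x, gamma y).
  move=> e; subst k; exact: (gamma_sle j_gt0 jk homy homx).
(* The constant f_j is f in M_j but the bold zero in M_k; likewise for t_j. *)
have extraR : (j < k)%N -> R (Jf ord_max, Jf ord0) /\ R (Jt ord_max, Jt ord0).
  move=> ltjk.
  have := homR (cf A j); rewrite (hom_f homx) (hom_f homy) /= ltnn ltjk.
  by have := homR (ct A j); rewrite (hom_t homx) (hom_t homy) /= ltnn ltjk.
have [jltk|kj|ejk] := ltngtP j k; last 1 first.
- have {ejk} ejk : j = k by exact: val_inj.
  have {}sR' := sR' ejk.
  move: ejk => e; subst k.
  case: j j_gt0 x homx y homy @R subR homR constR gR {jk extraR} sR sR'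
    => -[//|j] lt_j _ x homx y homy R subR homR constR gR sR sR'.
  apply: (dichotomies_separate subR (@mem_pairs true true) constR
    dichotomies_same).
  move=> T K inT subT; case: inT => [inT|[inT|[|[|//]]]].
  + by apply: (gR T K _ subT); left.
  + by apply: (gR T K _ subT); right; left.
  + case=> TE _; rewrite -TE; apply: sR => a; rewrite TE.
    by apply: subT; exists a.
  + case=> TE _; rewrite -TE; apply: sR' => a; rewrite TE.
    by apply: subT; exists a.
- have [R1 R2] := extraR jltk.
  case: k jltk y homy @R subR homR constR gR {jk extraR} sR {sR'} R1 R2
    => -[//|k] lt_k jltk y homy R subR homR constR gR sR R1 R2.
  case: j j_gt0 jltk x homx @R subR homR constR gR sR R1 R2
    => -[//|j] lt_j _ jltk x homx R subR homR constR gR sR R1 R2.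
  apply: (dichotomies_separate subR (@mem_pairs true true) _ dichotomies_lt).
    by move=> z; rewrite !in_cons => /or3P[/eqP->|/eqP->|/constR].
  move=> T K inT subT; case: inT => [[TE _]|inT]; last exact: (gR T K).
  by rewrite -TE; apply: sR => a; rewrite TE; apply: subT; exists a.
- by move: kj; rewrite ltnNge jk.
Qed.

Lemma gamma_interp (j k : 'I_n.+1) (x : A -> Msort j) (y : A -> Msort k) :
  @is_hom n A (M j) x -> @is_hom n A (M k) y ->
  exists a, gamma x = x a /\ gamma y = y a.
Proof.
move=> homx homy; case/orP: (leq_total j k) => [jk|kj].
  exact: gamma_interp_le.
by have [a []] := gamma_interp_le kj homy homx; exists a.
Qed.

End Interpolation.

(** * Interpolation and compactness *)

(** Points of [X] with the same [code] belong to the same [E a], [a] in [l]; one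
    interpolates over more and more codes. *)
Lemma majority_interpolation (X A : Type) (D : set X) (E : A -> set X)
    (maj : A -> A -> A -> A) (l : seq A) (a0 : A) :
  (forall a b c, (E a `&` E b) `|` (E b `&` E c) `|` (E a `&` E c)
     `<=` E (maj a b c)) ->
  (forall p q, D p -> D q -> exists2 a, List.In a l & E a p /\ E a q) ->
  exists a, D `<=` E a.
Proof.
move=> Emaj cover.
pose code p : seq bool := [seq `[< E a p >] | a <- l].
have codeE p q : code p = code q -> forall a, List.In a l -> E a p -> E a q.
  rewrite /code; elim: l {cover code} => //= b l IH [epq /IH{}IH] a.
  by case=> [<-|/IH //] /asboolP Ep; apply/asboolP; rewrite -epq.
suff inC (C : seq (seq bool)) :
    exists a, forall p, D p -> code p \in C -> E a p.
  (* [C] is taken to be the list of all boolean words of length [size l], hence contains every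
     code. *)
  have [a Ca] := inC [seq val t | t <- enum {: (size l).-tuple bool}].
  exists a => p Dp; apply: Ca => //; apply/mapP.
  have sz : size (code p) == size l by rewrite size_map.
  by exists (Tuple sz) => //; rewrite mem_enum.
have [N] := ubnP (size C); elim: N C => // N IH [|c [|d [|e C]]] sC.
- by exists a0.
- have [[p [Dp cp]]|noc] := pselect (exists p, D p /\ code p = c).
    have [a al [Ep _]] := cover p p Dp Dp; exists a => q Dq.
    rewrite inE => /eqP cq; apply: codeE al Ep; by rewrite cp.
  by exists a0 => q Dq; rewrite inE => /eqP cq; case: noc; exists q.
- have [[p [Dp cp]]|noc] := pselect (exists p, D p /\ code p = c); last first.
    have [|a Ea] := IH [:: d]; first by [].
    exists a => q Dq; rewrite in_cons => /orP[/eqP cq|]; last exact: Ea.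
    by case: noc; exists q.
  have [[q [Dq dq]]|nod] := pselect (exists p, D p /\ code p = d); last first.
    have [|a Ea] := IH [:: c]; first by [].
    exists a => q Dq; rewrite !in_cons orbC => /orP[/orP[/eqP dq|//]|cq].
      by case: nod; exists q.
    by apply: Ea => //; rewrite in_cons cq.
  have [a al [Ep Eq]] := cover p q Dp Dq; exists a => r Dr.
  rewrite !inE => /orP[] /eqP cr.
    by apply: codeE al Ep; rewrite cp.
  by apply: codeE al Eq; rewrite dq.
(* Three shorter lists, each omitting one of [c], [d], [e]: every code occurs in at least two of
   them, so the majority of the three interpolants is correct everywhere. *)
have [|a1 E1] := IH (d :: e :: C); first by [].
have [|a2 E2] := IH (c :: e :: C); first by [].
have [|a3 E3] := IH (c :: d :: C); first by [].
exists (maj a1 a2 a3) => p Dp pC; apply: Emaj.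
have {}E1 := E1 p Dp; have {}E2 := E2 p Dp; have {}E3 := E3 p Dp.
move: pC E1 E2 E3; rewrite !in_cons.
case/or4P=> ->; rewrite ?orbT => E1 E2 E3.
- by left; right; split; [exact: E2 | exact: E3].
- by right; split; [exact: E1 | exact: E3].
- by left; left; split; [exact: E1 | exact: E2].
- by left; left; split; [exact: E1 | exact: E2].
Qed.

(** * Compactness of the dual space *)

Lemma jelt_compact m : compact [set: jelt m].
Proof.
apply: finite_compact.
have := @finite_finset (jelt m : finType) [set: jelt m].
exact.
Qed.

Section DualSpace.
Variables (n : nat) (A : algebra n).

Lemma near_coord m (f : {ptws A -> jelt m}) a : \forall g \near f, g a = f a.
Proof.
have := @proj_continuous {classic A} (fun=> jelt m) a f.
move=> /(_ [set f a]); apply.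
by rewrite nbhs_principalE; exact/principal_filterP.
Qed.

(** Each equation defining a homomorphism involves finitely many coordinates, and on these a limit
    point coincides with some homomorphism. *)
Lemma homs_closed (k : 'I_n.+1) :
  closed ([set f | @is_hom n A (M k) f] : set {ptws A -> Msort k}).
Proof.
move=> f clf.
have near_hom (l : seq A) : exists2 g : A -> Msort k, @is_hom n A (M k) g &
    forall a, List.In a l -> g a = f a.
  have /clf [g [/= homg gl]] :
      nbhs f [set g | forall a, List.In a l -> g a = f a].
    elim: l => [|a l IH]; first by apply: filterS filterT => g _ b [].
    near=> g => b /= [<-|].
      by near: g; exact: (near_coord f a).
    by move: b; near: g; exact: IH.
  by exists g.
split=> [a b|a b|a b|a b|a||i|i|].
- have [g G gE] := near_hom [:: otimes a b; a; b].
  rewrite -!gE /=; try tauto. exact: hom_otimes G _ _.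
- have [g G gE] := near_hom [:: oplus a b; a; b].
  rewrite -!gE /=; try tauto. exact: hom_oplus G _ _.
- have [g G gE] := near_hom [:: wedge a b; a; b].
  rewrite -!gE /=; try tauto. exact: hom_wedge G _ _.
- have [g G gE] := near_hom [:: vee a b; a; b].
  rewrite -!gE /=; try tauto. exact: hom_vee G _ _.
- have [g G gE] := near_hom [:: neg a; a].
  rewrite -!gE /=; try tauto. exact: hom_neg G _.
- have [g G gE] := near_hom [:: ctop A].
  rewrite -!gE /=; try tauto. exact: hom_top G.
- have [g G gE] := near_hom [:: cf A i].
  rewrite -!gE /=; try tauto. exact: hom_f G _.
- have [g G gE] := near_hom [:: ct A i].
  rewrite -!gE /=; try tauto. exact: hom_t G _.
- have [g G gE] := near_hom [:: cbot A].
  rewrite -!gE /=; try tauto. exact: hom_bot G.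
Unshelve. all: by end_near. Qed.

Lemma dualset_compact : compact (dualset (A := A)).
Proof.
apply: (subclosed_compact _ (sigT_compact _ _)) => //.
- rewrite -openC; apply/sigT_openP => k.
  by have := @homs_closed k; rewrite -openC.
- exact: (@finite_finset 'I_n.+1).
- move=> k; have := @tychonoff {classic A} (fun=> Msort k) (fun=> setT).
  move=> /(_ (fun=> @jelt_compact _)); congr compact.
  by apply/seteqP; split.
Qed.

Variable gamma : forall k : 'I_n.+1, (A -> Msort k) -> Msort k.
Arguments gamma : clear implicits.

Definition agrees (a : A) : set (mspower A) :=
  [set p | gamma (projT1 p) (projT2 p) = (projT2 p : A -> Msort (projT1 p)) a].

Hypothesis gammaC : {within dualset (A := A), continuous (msmap gamma)}.

(** The sorts being discrete, both [gamma] and evaluation at [a] are locally constant, so agreement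
    is an open condition on the dual. *)
Lemma near_agrees a p : dualset p -> agrees a p ->
  \forall q \near p, dualset q -> agrees a q.
Proof.
case: p => k f Df ap.
have near_msmap : \forall q \near (existT _ k f : mspower A), dualset q ->
    msmap gamma q = existT _ k (gamma k f).
  move/subspace_continuousP: gammaC.
  move=> /(_ _ Df) /(_ [set existT _ k (gamma k f)]); apply.
  by rewrite /nbhs /= /sigT_nbhs /= /nbhs /=; exact/principal_filterP.
have near_gamma : \forall g \near (f : {ptws A -> Msort k}),
    dualset (existT _ k g) -> gamma k g = gamma k f.
  (* A neighbourhood of a point of the sum is, by conversion, one in its summand. *)
  have {near_msmap} : \forall g \near (f : {ptws A -> Msort k}),
      dualset (existT _ k g) ->
      msmap gamma (existT _ k g) = existT _ k (gamma k f) := near_msmap.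
  apply: filterS => g /= eq_msmap Dg; have /eqP := eq_msmap Dg.
  rewrite /msmap /=.
  rewrite -[X in _ == X]/(Tagged (fun k : 'I_n.+1 => Msort k) (gamma k f)).
  by rewrite eq_Tagged => /eqP.
have : \forall g \near (f : {ptws A -> Msort k}),
    dualset (existT _ k g) -> gamma k g = g a.
  apply: filterS2 near_gamma (near_coord f a) => g eq_gamma -> Dg.
  by rewrite eq_gamma.
exact.
Qed.

(** The sets of pairs at which a given [a] agrees twice form an open cover of the square of the
    dual, which is compact. *)
Lemma finite_cover :
  (forall p q : mspower A, dualset p -> dualset q ->
     exists a, agrees a p /\ agrees a q) ->
  exists l : seq A, forall p q : mspower A, dualset p -> dualset q ->
     exists2 a, List.In a l & agrees a p /\ agrees a q.
Proof.
(* [F] is the filter of lists that eventually contain any given list; a property holding near [F]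
   uniformly over the square yields a single list. *)
move=> cov; pose F := filter_from [set: seq A]
  (fun l => [set l' : seq A | forall a, List.In a l -> List.In a l']).
have FF : ProperFilter F.
  apply: filter_from_proper; last by move=> l _; exists l.
  apply: filter_from_filter; first by exists [::].
  move=> l1 l2 _ _; exists (l1 ++ l2)%SEQ => // l' /= H; split=> a al; apply: H;
    apply/List.in_app_iff; tauto.
pose P (l : seq A) (pq : mspower A * mspower A) :=
  dualset pq.1 -> dualset pq.2 ->
  exists2 a, List.In a l & agrees a pq.1 /\ agrees a pq.2.
have := compact_setX dualset_compact dualset_compact.
move/compact_near_coveringP => /(_ _ F P _) [].
  move=> [p q] [/= Dp Dq]; have [a [ap aq]] := cov p q Dp Dq.
  pose E := [set q : mspower A | dualset q -> agrees a q].
  exists ([set pq | E pq.1 /\ E pq.2], [set l | List.In a l]).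
    split => /=.
      exists (E, E); first by split; exact: near_agrees.
      by move=> [u v] [/= ? ?].
    by exists [:: a] => // l; apply; left.
  move=> [[u v] l] [/= [Eu Ev] al] Du Dv.
  by exists a => //; split; [exact: Eu | exact: Ev].
move=> l _ /(_ l (fun _ H => H)) H; exists l => p q Dp Dq.
exact: (H (p, q)).
Qed.

End DualSpace.

(** * The variety generated by J_n *)

(** Every element of J_n is named by a constant, so this is the only possible homomorphism from J_n
    to [A]; for [A = M k] it is the quotient map. *)
Definition interp_const n (A : algebra n) (v : jelt n) : A :=
  match v with
  | Top => ctop A
  | Bot => cbot A
  | Jf i => cf A i
  | Jt i => ct A i
  end.

Lemma hom_interp_const n (A B : algebra n) (h : A -> B) v :
  is_hom h -> h (interp_const A v) = interp_const B v.
Proof. by move=> H; case: v => [||i|i] /=; case: H. Qed.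

(** The reindexing [c] of the chains is monotone, hence commutes with max and min. It fixes the last
    index, as it must because Top and Bot have truth meet f_n and truth join t_n. *)
Lemma interp_const_hom n (k : 'I_n.+1) :
  @is_hom n (J n) (M k) (@interp_const n (M k)).
Proof.
have kmax : (n < k)%N = false by apply/negbTE; rewrite -leqNgt -ltnS.
pose c (i : 'I_n.+1) : 'I_(0 < k)%N.+1 :=
  if (i < k)%N then ord0 else ord_max.
have cle : {homo c : i j / (i <= j)%O}.
  move=> i j ij; rewrite /c; case: (ltnP j k) => [jk|_].
    by rewrite (leq_ltn_trans (ij : (i <= j)%N) jk).
  by case: ifP => _ //; exact: leq_ord.
have cmax i j : c (Order.max i j) = Order.max (c i) (c j).
  case: (leP i j) => [/cle|/ltW/cle] ?.
    by rewrite max_r.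
  by rewrite max_l.
have cmin i j : c (Order.min i j) = Order.min (c i) (c j).
  case: (leP i j) => [/cle|/ltW/cle] ?.
    by rewrite min_l.
  by rewrite min_r.
split=> //.
- by case=> [||i|i] [||j|j] //=; congr (_ _); exact: cmax.
- by case=> [||i|i] [||j|j] //=; congr (_ _); exact: cmin.
- by case=> [||i|i] [||j|j] //=; rewrite ?kmax //; congr (_ _);
    [exact: cmin | exact: cmax].
- by case=> [||i|i] [||j|j] //=; rewrite ?kmax //; congr (_ _);
    [exact: cmax | exact: cmin].
- by case.
Qed.

Lemma hom_factor n (A B C : algebra n) (h : A -> B) (g : A -> C) :
  is_hom h -> is_hom g -> (forall b, exists a, h a = b) ->
  (forall a a', h a = h a' -> g a = g a') ->
  exists2 z : B -> C, is_hom z & forall a, z (h a) = g a.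
Proof.
move=> H G /choice[s hs] hg; exists (fun b => g (s b)) => [|a]; last exact: hg.
split=> [a b|a b|a b|a b|a||i|i|].
- by rewrite -(hom_otimes G); apply: hg; rewrite (hom_otimes H) !hs.
- by rewrite -(hom_oplus G); apply: hg; rewrite (hom_oplus H) !hs.
- by rewrite -(hom_wedge G); apply: hg; rewrite (hom_wedge H) !hs.
- by rewrite -(hom_vee G); apply: hg; rewrite (hom_vee H) !hs.
- by rewrite -(hom_neg G); apply: hg; rewrite (hom_neg H) !hs.
- by rewrite -(hom_top G); apply: hg; rewrite (hom_top H) !hs.
- by rewrite -(hom_f G); apply: hg; rewrite (hom_f H) !hs.
- by rewrite -(hom_t G); apply: hg; rewrite (hom_t H) !hs.
- by rewrite -(hom_bot G); apply: hg; rewrite (hom_bot H) !hs.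
Qed.

Section Subalgebra.
Variables (n : nat) (A : algebra n) (S : set A).
Hypothesis subS : is_subuniverse S.

Definition subalgebra : algebra n := @Algebra n {a : A | S a}
  (fun a b => exist _ _ (sub_otimes subS (proj2_sig a) (proj2_sig b)))
  (fun a b => exist _ _ (sub_oplus subS (proj2_sig a) (proj2_sig b)))
  (fun a b => exist _ _ (sub_wedge subS (proj2_sig a) (proj2_sig b)))
  (fun a b => exist _ _ (sub_vee subS (proj2_sig a) (proj2_sig b)))
  (fun a => exist _ _ (sub_neg subS (proj2_sig a)))
  (exist _ _ (sub_top subS)) (fun i => exist _ _ (sub_f subS i))
  (fun i => exist _ _ (sub_t subS i)) (exist _ _ (sub_bot subS)).

Lemma subalgebra_hom : @is_hom n subalgebra A (fun a => proj1_sig a).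
Proof. by []. Qed.

Lemma subalgebra_inj (a b : subalgebra) : proj1_sig a = proj1_sig b -> a = b.
Proof.
case: a b => [a Sa] [b Sb] /= ab; subst b; congr exist.
exact: Prop_irrelevance.
Qed.

End Subalgebra.

(** * Limits of homomorphisms along an ultrafilter *)

Section UltraLimit.
Variables (I : Type) (U : set_system I).
Hypothesis ultraU : UltraFilter U.

(** With finitely many values, an ultrafilter must select one of them: it cannot contain the
    complements of all the fibres. *)
Lemma ultra_limit (X : Type) m (y : I -> X -> jelt m) :
  exists z : X -> jelt m, forall b, U [set i | y i b = z b].
Proof.
suff /choice[z zP] : forall b, exists v, U [set i | y i b = v] by exists z.
move=> b.
apply: contrapT => /forallNP noU.
have : U (fun i => forall v : jelt m, y i b <> v).
  apply: filter_forall => v.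
  by have [/noU//|] := @in_ultra_setVsetC _ _ [set i | y i b = v] ultraU.
by move=> /filter_ex[i /(_ (y i b))].
Qed.

(** Each equation mentions at most three elements, whose limit values are attained together at some
    index. *)
Lemma ultra_limit_hom n (B : algebra n) m (c : 'I_n.+1 -> 'I_m.+1)
    (y : I -> B -> jalg c) (z : B -> jalg c) :
  (forall i, is_hom (y i)) -> (forall b, U [set i | y i b = z b]) -> is_hom z.
Proof.
move=> Y yz.
have lim a b d : exists i, [/\ y i a = z a, y i b = z b & y i d = z d].
  have [|i [? [? ?]]] := @filter_ex _ U _ ([set i | y i a = z a] `&`
    ([set i | y i b = z b] `&` [set i | y i d = z d])); last by exists i.
  by apply: filterI => //; exact: filterI.
split=> [a b|a b|a b|a b|a||i|i|].
- by have [i [<- <- <-]] := lim (otimes a b) a b; exact: hom_otimes (Y i) _ _.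
- by have [i [<- <- <-]] := lim (oplus a b) a b; exact: hom_oplus (Y i) _ _.
- by have [i [<- <- <-]] := lim (wedge a b) a b; exact: hom_wedge (Y i) _ _.
- by have [i [<- <- <-]] := lim (vee a b) a b; exact: hom_vee (Y i) _ _.
- by have [i [<- <- _]] := lim (neg a) a a; exact: hom_neg (Y i) _.
- by have [i [<- _ _]] := lim (ctop B) (ctop B) (ctop B); exact: hom_top (Y i).
- by have [j [<- _ _]] := lim (cf B i) (ctop B) (ctop B); exact: hom_f (Y j) _.
- by have [j [<- _ _]] := lim (ct B i) (ctop B) (ctop B); exact: hom_t (Y j) _.
- by have [i [<- _ _]] := lim (cbot B) (ctop B) (ctop B); exact: hom_bot (Y i).
Qed.

End UltraLimit.

(** * The truth order and its join-prime elements *)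

Section TruthOrder.
Variable m : nat.
Implicit Types x y z q : jelt m.

Lemma tlexx x : tle x x. Proof. by case: x => /=. Qed.

Lemma tle_trans y x z : tle x y -> tle y z -> tle x z.
Proof.
case: x y z => [||i|i] [||j|j] [||k|k] //=; first exact: leq_trans.
by move=> ji kj; exact: leq_trans kj ji.
Qed.

Lemma tle_join_r x y : tle x y -> tjoin x y = y.
Proof.
move=> xy; apply: tle_anti; first by rewrite tjoinP xy tlexx.
by have := tlexx (tjoin x y); rewrite {1}tjoinP => /andP[].
Qed.

Lemma tle_meet_join x x' y y' : tle x y -> tle (tmeet x x') (tjoin y y').
Proof.
have /andP[mx _] : tle (tmeet x x') x && tle (tmeet x x') x'.
  by rewrite -tmeetP tlexx.
have /andP[yj _] : tle y (tjoin y y') && tle y' (tjoin y y').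
  by rewrite -tjoinP tlexx.
by move=> xy; exact: tle_trans (tle_trans mx xy) yj.
Qed.

Lemma tle_neg x y : tle (jneg x) (jneg y) = tle y x.
Proof. by case: x y => [||i|i] [||j|j]. Qed.

(** [Jt ord_max = tjoin Top Bot] is the only join-reducible element. *)
Lemma tle_prime q x y : q != Jt ord_max ->
  tle q (tjoin x y) = tle q x || tle q y.
Proof.
have not_last (k : 'I_m.+1) : Jt k != Jt ord_max -> (m <= k)%N = false.
  move=> kN; apply: contra_neqF kN => mk.
  by congr Jt; apply/val_inj/anti_leq; rewrite leq_ord.
case: q x y => [||k|k] [||i|i] [||j|j] //= qN;
  rewrite ?orbT ?orbF ?orbb ?leq_ord ?not_last //.
- exact: (@le_max _ 'I_m.+1 k i j).
- exact: (@ge_min _ 'I_m.+1 k i j).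
Qed.

Lemma tle_ext x y :
  (forall q, q != Jt ord_max -> tle q x = tle q y) -> x = y.
Proof.
have sub u v : (forall q, q != Jt ord_max -> tle q u = tle q v) -> tle u v.
  move=> uv; have [ut|uN] := eqVneq u (Jt ord_max); last by rewrite -uv ?tlexx.
  (* The excluded element t_n is the join of Top and Bot, which are allowed as tests. *)
  have := uv Top isT; have := uv Bot isT; rewrite ut /=.
  by case: v {uv} => [||i|i] //= _ _; rewrite leq_ord.
by move=> xy; apply: tle_anti; apply: sub => // q qN; rewrite xy.
Qed.

End TruthOrder.

(** * Prime filters of J_n and the quotients M_k *)

Section PrimeFiltersOfJ.
Variable n : nat.

Definition compatible (Q : set (jelt n)) (rho : set (jelt n * jelt n)) :=
  forall u v, rho (u, v) -> (Q u <-> Q v).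

(** The prime filter [Q] of J_n is the inverse image under J_n -> M_k of a set
    that translations use to separate the points of M_k. *)
Definition recognises (Q : set (jelt n)) (k : 'I_n.+1) :=
  (forall u v, interp_const (M k) u = interp_const (M k) v -> Q u -> Q v) /\
  (forall rho, @is_subuniverse n (pair_algebra (J n) (J n)) rho ->
     compatible Q rho -> forall u v, rho (u, v) ->
     interp_const (M k) u = interp_const (M k) v).

(** Negation reverses the truth order, so this complement turns a prime filter containing f_n into
    one omitting t_n. *)
Lemma recognises_neg (Q : set (jelt n)) k :
  recognises [set v | ~ Q (jneg v)] k -> recognises Q k.
Proof.
have negK : involutive (@jneg n) by case.
case=> fibre sep; split=> [u v uv Qu|rho subrho comp u v].
  apply: contrapT => nQv; have := fibre (jneg v) (jneg u).
  rewrite /= !negK; apply => //.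
  have cneg w : interp_const (M k) (jneg w) = neg (interp_const (M k) w).
    exact: (hom_neg (interp_const_hom k)).
  by rewrite !cneg uv.
apply: sep => // {}u {}v uv /=; have := comp _ _ (sub_neg subrho uv).
by rewrite /=; tauto.
Qed.

Definition t_below (k : nat) (v : jelt n) : bool :=
  if v is Jt i then (i < k)%N else false.

(** This set is {t_0, ..., t_(k-1)}, the fibre over the bold one of M_k. *)
Lemma recognises_high (k : 'I_n.+1) : (0 < k)%N ->
  recognises [set v | t_below k v] k.
Proof.
move=> k_gt0; have ord0max : ord0 <> ord_max :> 'I_(0 < k)%N.+1.
  by move/(congr1 val); rewrite /= k_gt0.
split=> [u v|rho subrho comp u v uv].
  case: u => [||i|i] //= + ik; rewrite ik.
  by case: v => [||j|j] //= [] /=; case: ifP => // _ /ord0max.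
pose Q := t_below k.
have QE w z : rho (w, z) -> Q w = Q z.
  by move=> /comp[wz zw]; exact/idP/idP.
have uv' := sub_neg subrho uv.
have t0 := sub_t subrho ord0.
(* Membership of [v], of its negation, and of their knowledge meets and joins with t_0 tells the six
   elements of M_k apart. *)
have := (QE _ _ uv, QE _ _ uv',
  QE _ _ (sub_otimes subrho uv t0), QE _ _ (sub_oplus subrho uv t0),
  QE _ _ (sub_otimes subrho uv' t0), QE _ _ (sub_oplus subrho uv' t0)).
have max0 (i : 'I_n.+1) : Order.max i ord0 = i.
  by apply/max_idPl; exact: leq0n.
have min0 (i : 'I_n.+1) : Order.min i ord0 = ord0.
  by apply/min_idPr; exact: leq0n.
by case: u v {uv uv'} => [||i|i] [||j|j] //=;
  rewrite ?max0 ?min0 ?k_gt0 => -[[[[[H1 H2] H3] H4] H5] H6] //;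
  rewrite ?H1 ?H2.
Qed.

(** Membership of [v] and of its negation in [Q] already tells the four elements of M_0 apart. *)
Lemma recognises_middle (Q : set (jelt n)) :
  (forall i, Q (Jt i)) -> (forall i, ~ Q (Jf i)) -> (Q Top <-> ~ Q Bot) ->
  recognises Q ord0.
Proof.
move=> Qt nQf QTB; split=> [u v|rho subrho comp u v uv].
  by case: u v => [||i|i] [||j|j] //= _; try by [move=> /nQf | move=> _].
have := comp _ _ uv; have := comp _ _ (sub_neg subrho uv).
case: u v {uv} => [||i|i] [||j|j] //=.
all: try (have := Qt i; have := nQf i); try (have := Qt j; have := nQf j).
all: by intros; exfalso; tauto.
Qed.

(** Three positions of [Q]: it contains f_n (the negated form of the second case), it omits t_n
    (some k > 0), or its least chain elements separate exactly the t_i from the f_i (k = 0). *)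
Lemma prime_filter_recognises (Q : set (jelt n)) :
  (forall u v, Q u -> tle u v -> Q v) -> Q (Jt ord0) -> ~ Q (Jf ord0) ->
  (Q Top -> Q Bot -> Q (Jf ord_max)) -> (Q (Jt ord_max) -> Q Top \/ Q Bot) ->
  exists k, recognises Q k.
Proof.
move=> up Qt0 nQf0 meetQ joinQ.
have high (P : set (jelt n)) : (forall u v, P u -> tle u v -> P v) ->
    P (Jt ord0) -> ~ P (Jt ord_max) -> exists k, recognises P k.
  move=> upP Pt0 nPt.
  have Pmax : (fun i => ~~ `[< P (Jt i) >]) ord_max by apply/asboolPn.
  (* [k] is the least index such that t_k lies outside [P]. *)
  case: (@arg_minnP _ ord_max (fun i => ~~ `[< P (Jt i) >]) val Pmax).
  move=> k Pk mink.
  have k_gt0 : (0 < k)%N.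
    rewrite lt0n; apply: contraNneq Pk => k0; apply/asboolP.
    by rewrite (_ : k = ord0) //; exact/val_inj.
  exists k.
  suff -> : P = [set v | t_below k v].
    exact: recognises_high.
  have nP v : tle v (Jt k) -> ~ P v.
    by move=> vk Pv; move/asboolPn: Pk; apply; exact: upP vk.
  apply/seteqP; split=> -[||i|i] //=; try by move=> Pv; case: (nP _ _ Pv).
    by move=> Pi; rewrite ltnNge; apply/negP => ki; case: (nP _ _ Pi).
  move=> ik; apply: contrapT => /asboolPn /mink /=.
  by rewrite leqNgt ik.
have [Qf|nQf] := pselect (Q (Jf ord_max)).
  have [|||k recP] := high [set v | ~ Q (jneg v)];
    [.. | by exists k; exact: recognises_neg].
  - by move=> u v /= nQu uv Qv; apply: nQu; apply: up Qv _; rewrite tle_neg.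
  - by [].
  - by move=> /=; tauto.
have [Qt|nQt] := pselect (Q (Jt ord_max)); last exact: high.
exists ord0; apply: recognises_middle.
- by move=> i; apply: up Qt _; rewrite /= leq_ord.
- by move=> i Qi; apply: nQf; apply: up Qi _; rewrite /= leq_ord.
- by have := joinQ Qt; have := nQf; tauto.
Qed.

End PrimeFiltersOfJ.

(** * Homomorphisms to the sorts separate the points of an algebra in the variety *)

Section Separation.
Variables (n : nat) (A B : algebra n) (I : Type).
Variables (h : B -> A) (e : B -> @prod_algebra n I (fun=> J n)).
Hypotheses (homh : is_hom h) (surjh : forall a, exists b, h b = a).
Hypotheses (home : is_hom e) (inje : injective e).

Lemma e_hom i : @is_hom n B (J n) (fun b => e b i).
Proof.
by split=> *; rewrite ?(hom_otimes home, hom_oplus home, hom_wedge home,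
  hom_vee home, hom_neg home, hom_top home, hom_f home, hom_t home,
  hom_bot home).
Qed.

Lemma lattice_ext (b c : B) :
  (forall i q, q != Jt ord_max -> tle q (e b i) = tle q (e c i)) -> b = c.
Proof.
by move=> bc; apply: inje; apply/funext => i; apply: tle_ext => q; exact: bc.
Qed.

(** An identity in [A] is lifted to [B] and read in each coordinate. There, lying above a join-prime
    [q] commutes with meet and join, so a boolean case check remains. *)
Ltac lattice :=
  let i := fresh "i" in let q := fresh "q" in let qN := fresh "qN" in
  rewrite -?(hom_wedge homh, hom_vee homh);
  congr h; apply: lattice_ext; intros i q qN;
  rewrite ?(hom_wedge (e_hom i), hom_vee (e_hom i)) /=;
  rewrite ?(tmeetP, tle_prime _ _ qN);
  repeat match goal with |- context [e ?b i] => case: (tle q (e b i)) end; done.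

Local Notation "x /|\ y" := (@wedge n A x y) (at level 40).
Local Notation "x \|/ y" := (@vee n A x y) (at level 50).

Lemma veeA x y z : x \|/ (y \|/ z) = x \|/ y \|/ z.
Proof.
by case: (surjh x) (surjh y) (surjh z) => x' <- [y' <-] [z' <-]; lattice.
Qed.

Lemma veexx x : x \|/ x = x.
Proof. by case: (surjh x) => x' <-; lattice. Qed.

Lemma wedgexx x : x /|\ x = x.
Proof. by case: (surjh x) => x' <-; lattice. Qed.

Lemma vee_wedgeK x y : (x /|\ y) \|/ x = x.
Proof. by case: (surjh x) (surjh y) => x' <- [y' <-]; lattice. Qed.

Lemma vee_wedgeKr x y : (x /|\ y) \|/ y = y.
Proof. by case: (surjh x) (surjh y) => x' <- [y' <-]; lattice. Qed.

(** Here and below, x lies under y is written as [x \|/ y = y]. This is what makes the filter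
    generated by a filter and an element closed under meets. *)
Lemma wedge_below f f' u w w' :
  let t := ((f /|\ u) \|/ w) /|\ ((f' /|\ u) \|/ w') in
  ((f /|\ f') /|\ u) \|/ t = t.
Proof.
move=> t; rewrite /t.
by case: (surjh f) (surjh f') (surjh u) (surjh w) (surjh w')
  => f1 <- [f2 <-] [u1 <-] [w1 <-] [w2 <-]; lattice.
Qed.

(** Applied when [f /|\ u] and [f' /|\ v] lie under [b], so that [t] is [b]: the step of the prime
    filter theorem that rests on distributivity. *)
Lemma distributive_below f f' u v b :
  let t := (f /|\ u) \|/ ((f' /|\ v) \|/ b) in
  ((f /|\ f') /|\ (u \|/ v)) \|/ t = t.
Proof.
move=> t; rewrite /t.
by case: (surjh f) (surjh f') (surjh u) (surjh v) (surjh b)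
  => f1 <- [f2 <-] [u1 <-] [v1 <-] [b1 <-]; lattice.
Qed.

Definition lattice_filter (F : set A) :=
  (forall x y, F x -> F y -> F (x /|\ y)) /\ (forall x y, F x -> F (x \|/ y)).

Lemma filter_le F x y : lattice_filter F -> F x -> x \|/ y = y -> F y.
Proof. by move=> [_ up] Fx <-; exact: up. Qed.

(** A filter maximal among those containing [a] and omitting [b] is prime. *)
Lemma prime_filter_exists (a b : A) : a \|/ b <> b ->
  exists F, [/\ lattice_filter F, F a, ~ F b &
    forall x y, F (x \|/ y) -> F x \/ F y].
Proof.
move=> ab.
pose P := [set F : set A | F = set0 \/ [/\ lattice_filter F, F a & ~ F b]].
have [C CP totC|F [FP maxF]] := @Zorn_bigcup A P.
  have [[X [CX Xa]]|noX] := pselect (exists X, C X /\ X a); last first.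
    left; apply/seteqP; split=> // x [X CX Xx].
    have [X0|[_ Xa _]] := CP X CX; first by move: Xx; rewrite X0.
    by case: noX; exists X.
  have filt Y y : C Y -> Y y -> [/\ lattice_filter Y, Y a & ~ Y b].
    by move=> CY Yy; have [Y0|//] := CP Y CY; move: Yy; rewrite Y0.
  right; split; first 1 last.
  - by exists X.
  - by move=> [Y CY Yb]; have [_ _] := filt Y b CY Yb.
  split=> [x y [Y CY Yx] [Z CZ Zy]|x y [Y CY Yx]]; last first.
    by exists Y => //; have [[_ up] _ _] := filt Y x CY Yx; exact: up.
  have [YZ|ZY] := totC Y Z CY CZ.
    exists Z => //; have [[wedgeZ _] _ _] := filt Z y CZ Zy.
    by apply: wedgeZ => //; exact: YZ.
  exists Y => //; have [[wedgeY _] _ _] := filt Y x CY Yx.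
  by apply: wedgeY => //; exact: ZY.
have up_a : P [set w | a \|/ w = w].
  right; split=> //=; last exact: veexx.
  split=> x y /=; last by move=> ax; rewrite veeA ax.
  move=> ax ay; have := wedge_below a a a x y.
  by rewrite /= !wedgexx ax ay.
have [F0|[filtF Fa nFb]] := FP.
  case: (maxF [set w | a \|/ w = w]) => //; rewrite F0 properEneq; split=> //.
  by apply/eqP => E; have : set0 a by rewrite E /=; exact: veexx.
exists F; split=> // x y Fxy; apply: contrapT => /not_orP[nFx nFy].
have [wedgeF _] := filtF.
(* [G u] is the filter generated by [F] and [u]; by maximality it contains [b] as soon as [u] is not
   in [F]. *)
pose G u := [set w | exists2 f, F f & (f /|\ u) \|/ w = w].
have GP u : ~ F u -> G u b.
  move=> nFu; apply: contrapT => nGb; apply: (maxF (G u)).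
    rewrite properEneq; split.
      apply/eqP => E; apply: nFu; rewrite E.
      by exists a => //; exact: vee_wedgeKr.
    by move=> f Ff; exists f => //; exact: vee_wedgeK.
  right; split=> //; last by exists a => //; exact: vee_wedgeK.
  split=> w w' [f Ff fw].
    move=> [f' Ff' fw']; exists (f /|\ f'); first exact: wedgeF.
    by have := wedge_below f f' u w w'; rewrite /= fw fw'.
  by exists f => //; rewrite veeA fw.
have [f Ff fb] := GP x nFx; have [f' Ff' fb'] := GP y nFy.
apply: nFb; apply: (@filter_le F ((f /|\ f') /|\ (x \|/ y))) => //.
  by apply: (wedgeF) => //; exact: wedgeF.
by have := distributive_below f f' x y b; rewrite /= fb' fb.
Qed.

Lemma separating_hom_le (a b : A) : a \|/ b <> b ->
  exists (k : 'I_n.+1) (z : A -> M k), is_hom z /\ z a <> z b.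
Proof.
move=> /prime_filter_exists[F [filtF Fa nFb primeF]].
have [wedgeF veeF] := filtF.
have [a' ha] := surjh a; have [b' hb] := surjh b.
(* An ultrafilter above [base] forces the limit [y] never to put an element over [F] below one that
   is not over [F]. *)
pose base := filter_from [set cd : B * B | F (h cd.1) /\ ~ F (h cd.2)]
  (fun cd => [set i | ~~ tle (e cd.1 i) (e cd.2 i)]).
have baseF : ProperFilter base.
  apply: filter_from_proper.
    apply: filter_from_filter; first by exists (a', b'); rewrite /= ha hb.
    move=> [c d] [c' d'] /= [Fc nFd] [Fc' nFd'].
    exists (wedge c c', vee d d') => /=.
      rewrite (hom_wedge homh) (hom_vee homh); split; first exact: wedgeF.
      by move=> /primeF[].
    move=> i /=; rewrite (hom_wedge (e_hom i)) (hom_vee (e_hom i)) => nle.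
    split; apply: contra nle; first exact: tle_meet_join.
    move=> le'; have := @tle_meet_join _ _ (e c i) _ (e d i) le'.
    rewrite /=; congr tle.
      by apply: tle_ext => q _; rewrite !tmeetP andbC.
    by apply: tle_ext => q qN; rewrite !tle_prime // orbC.
  move=> [c d] /= [Fc nFd]; apply: contrapT => /forallNP none; apply: nFd.
  apply: (filter_le filtF Fc); rewrite -(hom_vee homh); congr h.
  apply: inje; apply/funext => i; rewrite (hom_vee (e_hom i)).
  by apply: tle_join_r; apply/negPn/negP; exact: none.
have [U [ultraU baseU]] := ultraFilterLemma baseF.
have [y ey] := ultra_limit ultraU (fun i b => e b i : jelt n).
have homy : @is_hom n B (J n) y := ultra_limit_hom ultraU e_hom ey.
have ynle c d : F (h c) -> ~ F (h d) -> ~~ tle (y c) (y d).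
  move=> Fc nFd.
  have Ucd : U [set i | ~~ tle (e c i) (e d i)] by apply: baseU; exists (c, d).
  have [|i [/= ? [<- <-]]] := @filter_ex _ U _ ([set i | ~~ tle (e c i) (e d i)]
    `&` ([set i | e c i = y c] `&` [set i | e d i = y d])); last by [].
  by apply: filterI => //; apply: filterI; exact: ey.
(* Since [y] fixes the constants, comparing [c] with the constant named by [y c] shows that the
   pullback of [F] is that of [Q]. *)
pose Q : set (jelt n) := [set v | F (interp_const A v)].
have yK v : y (interp_const B v) = v.
  by rewrite (hom_interp_const _ homy); case: v.
have FQ c : F (h c) <-> Q (y c).
  rewrite /Q /= -(hom_interp_const _ homh); split=> Fc; apply: contrapT => nF.
    by have := ynle _ _ Fc nF; rewrite yK tlexx.
  by have := ynle _ _ Fc nF; rewrite yK tlexx.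
have upQ u v : Q u -> tle u v -> Q v.
  move=> Qu uv; apply: contrapT => nQv.
  have := ynle (interp_const B u) (interp_const B v).
  by rewrite !yK uv !(hom_interp_const _ homh) => /(_ Qu nQv).
have [|||||k [fibre sep]] := @prime_filter_recognises n Q.
- exact: upQ.
- have := Fa; rewrite -ha FQ => /upQ; apply; by case: (y a').
- by move=> Qf; apply: nFb; rewrite -hb FQ; apply: (upQ _ _ Qf); case: (y b').
- move=> QT QB; have : F (ctop A /|\ cbot A) := wedgeF _ _ QT QB.
  rewrite -(hom_top homh) -(hom_bot homh) -(hom_wedge homh) FQ.
  by rewrite (hom_wedge homy) (hom_top homy) (hom_bot homy).
- move=> Qt; apply: (primeF (ctop A) (cbot A)).
  rewrite -(hom_top homh) -(hom_bot homh) -(hom_vee homh) FQ.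
  by rewrite (hom_vee homy) (hom_top homy) (hom_bot homy).
(* The image under [y] of the kernel of [h]. It is compatible with [Q], so recognition makes the map
   from [B] to M_k factor through [h]. *)
pose rho : set (jelt n * jelt n) :=
  [set uv | exists c d, [/\ h c = h d, y c = uv.1 & y d = uv.2]].
have subrho : @is_subuniverse n (pair_algebra (J n) (J n)) rho.
  split=> [a1 a2|a1 a2|a1 a2|a1 a2|a1||i|i|].
  - move=> [c [d [hcd cu dv]]] [c' [d' [hcd' cu' dv']]].
    exists (otimes c c'), (otimes d d'); split.
    + by rewrite !(hom_otimes homh) hcd hcd'.
    + by rewrite (hom_otimes homy) cu cu'.
    + by rewrite (hom_otimes homy) dv dv'.
  - move=> [c [d [hcd cu dv]]] [c' [d' [hcd' cu' dv']]].
    exists (oplus c c'), (oplus d d'); split.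
    + by rewrite !(hom_oplus homh) hcd hcd'.
    + by rewrite (hom_oplus homy) cu cu'.
    + by rewrite (hom_oplus homy) dv dv'.
  - move=> [c [d [hcd cu dv]]] [c' [d' [hcd' cu' dv']]].
    exists (wedge c c'), (wedge d d'); split.
    + by rewrite !(hom_wedge homh) hcd hcd'.
    + by rewrite (hom_wedge homy) cu cu'.
    + by rewrite (hom_wedge homy) dv dv'.
  - move=> [c [d [hcd cu dv]]] [c' [d' [hcd' cu' dv']]].
    exists (vee c c'), (vee d d'); split.
    + by rewrite !(hom_vee homh) hcd hcd'.
    + by rewrite (hom_vee homy) cu cu'.
    + by rewrite (hom_vee homy) dv dv'.
  - move=> [c [d [hcd cu dv]]]; exists (neg c), (neg d); split.
    + by rewrite !(hom_neg homh) hcd.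
    + by rewrite (hom_neg homy) cu.
    + by rewrite (hom_neg homy) dv.
  - by exists (ctop B), (ctop B); rewrite (hom_top homy).
  - by exists (cf B i), (cf B i); rewrite (hom_f homy).
  - by exists (ct B i), (ct B i); rewrite (hom_t homy).
  - by exists (cbot B), (cbot B); rewrite (hom_bot homy).
have comp : compatible Q rho.
  by move=> _ _ [c [d /= [hcd <- <-]]]; rewrite -!FQ hcd.
have homr : @is_hom n B (M k) (fun c => interp_const (M k) (y c)).
  exact: (hom_comp homy (interp_const_hom k)).
have [|z homz zh] := @hom_factor n B A (M k) h _ homh homr surjh.
  by move=> c d hcd; apply: (sep rho subrho comp); exists c, d.
exists k, z; split=> // zab; apply: nFb; rewrite -hb FQ.
apply: (fibre (y a')); last by rewrite -FQ ha.
by rewrite -!zh ha hb.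
Qed.

Lemma veeC x y : x \|/ y = y \|/ x.
Proof. by case: (surjh x) (surjh y) => x' <- [y' <-]; lattice. Qed.

Lemma separating_hom (a b : A) : a <> b ->
  exists (k : 'I_n.+1) (z : A -> M k), is_hom z /\ z a <> z b.
Proof.
move=> ab; have [abb|] := pselect (a \|/ b = b); last exact: separating_hom_le.
have [|k [z [homz zba]]] := @separating_hom_le b a.
  by rewrite veeC abb => /esym.
by exists k, z; split=> // zab; apply: zba.
Qed.

End Separation.

(** * The two descriptions of the variety *)

Lemma HSP_J_sub_ISP_M n (A : algebra n) : V_ n A ->
  ISP (fun B : algebra n => exists k : 'I_n.+1, B = M k) A.
Proof.
move=> [B [_ [I [K [KJ ->]]] [e [home inje]]] [h [homh surjh]]].
have KE : K = fun=> J n by apply/funext => i; exact: KJ.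
move: e home inje; rewrite KE => e home inje.
pose I' :=
  {p : {k : 'I_n.+1 & A -> M k} | @is_hom n A (M (projT1 p)) (projT2 p)}.
pose sort (p : I') := projT1 (proj1_sig p).
exists (@prod_algebra n I' (fun p => M (sort p))).
  by exists I', (fun p => M (sort p)); split=> // p; exists (sort p).
exists (fun a p => (projT2 (proj1_sig p) : A -> M (sort p)) a); split.
  by split=> *; apply: functional_extensionality_dep => -[[k z] /= Z]; case: Z.
move=> a b ab; apply: contrapT => neq.
have [k [z [homz zab]]] := separating_hom homh surjh home inje neq.
apply: zab.
exact: (congr1 (fun f => f (exist _ (existT _ k z) homz)) ab).
Qed.

(** The power of J_n maps coordinatewise onto the product of sorts by [r]; [A] is a quotient of the
    preimage [S] of its copy there. *)
Lemma ISP_M_sub_HSP_J n (A : algebra n) :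
  ISP (fun B : algebra n => exists k : 'I_n.+1, B = M k) A -> V_ n A.
Proof.
move=> [_ [I [B [/choice[k BE] ->]]] [e [home inje]]].
have BM : B = fun i => M (k i) by exact: functional_extensionality_dep.
move: e home inje; rewrite BM.
move=> e home inje.
pose r (s : I -> jelt n) : prod_algebra (fun i => M (k i)) :=
  fun i => interp_const (M (k i)) (s i).
have homr : @is_hom n (prod_algebra (fun=> J n)) _ r.
  have H i := interp_const_hom (k i).
  by split=> [s s'|s s'|s s'|s s'|s||c|c|];
    apply: functional_extensionality_dep => i;
    [exact: (hom_otimes (H i))|exact: (hom_oplus (H i))|exact: (hom_wedge (H i))
    |exact: (hom_vee (H i))|exact: (hom_neg (H i))|exact: (hom_top (H i))
    |exact: (hom_f (H i))|exact: (hom_t (H i))|exact: (hom_bot (H i))].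
pose S : set (@prod_algebra n I (fun=> J n)) := [set s | exists a, e a = r s].
have subS : is_subuniverse S.
  split=> [s s'|s s'|s s'|s s'|s||i|i|].
  - move=> [a ea] [a' ea']; exists (otimes a a').
    by rewrite (hom_otimes homr) -ea -ea' (hom_otimes home).
  - move=> [a ea] [a' ea']; exists (oplus a a').
    by rewrite (hom_oplus homr) -ea -ea' (hom_oplus home).
  - move=> [a ea] [a' ea']; exists (wedge a a').
    by rewrite (hom_wedge homr) -ea -ea' (hom_wedge home).
  - move=> [a ea] [a' ea']; exists (vee a a').
    by rewrite (hom_vee homr) -ea -ea' (hom_vee home).
  - by move=> [a ea]; exists (neg a); rewrite (hom_neg homr) -ea (hom_neg home).
  - by exists (ctop A); rewrite (hom_top homr) (hom_top home).
  - by exists (cf A i); rewrite (hom_f homr) (hom_f home).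
  - by exists (ct A i); rewrite (hom_t homr) (hom_t home).
  - by exists (cbot A); rewrite (hom_bot homr) (hom_bot home).
have /choice[h hE] :
    forall s : subalgebra subS, exists a, e a = r (proj1_sig s).
  by move=> [s Ss].
exists (subalgebra subS); last first.
  exists h; split.
    split=> [s s'|s s'|s s'|s s'|s||i|i|]; apply: inje; rewrite hE.
    - by rewrite (hom_otimes home) !hE -(hom_otimes homr).
    - by rewrite (hom_oplus home) !hE -(hom_oplus homr).
    - by rewrite (hom_wedge home) !hE -(hom_wedge homr).
    - by rewrite (hom_vee home) !hE -(hom_vee homr).
    - by rewrite (hom_neg home) !hE -(hom_neg homr).
    - by rewrite (hom_top home) -(hom_top homr).
    - by rewrite (hom_f home) -(hom_f homr).
    - by rewrite (hom_t home) -(hom_t homr).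
    - by rewrite (hom_bot home) -(hom_bot homr).
  move=> a.
  have surj i (w : M (k i)) : exists v : jelt n, interp_const (M (k i)) v = w.
    case: w => [||j|j]; [by exists Top|by exists Bot|..].
      case: (ord_boolE j) => ->; first by exists (Jf ord0); exact: M_f0.
      by exists (Jf ord_max); exact: M_fmax.
    case: (ord_boolE j) => ->; first by exists (Jt ord0); exact: M_t0.
    by exists (Jt ord_max); exact: M_tmax.
  have /choice[s sE] : forall i, exists v, interp_const (M (k i)) v = e a i.
    by move=> i; exact: surj.
  have es : e a = r s.
    by apply: functional_extensionality_dep => i; rewrite /r sE.
  have Ss : S s by exists a.
  by exists (exist _ s Ss); apply: inje; rewrite hE.
exists (prod_algebra (fun _ : I => J n)).
  by exists I, (fun=> J n).
exists (fun s => proj1_sig s); split; first exact: subalgebra_hom.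
exact: subalgebra_inj.
Qed.

(** * The majority term and the duality *)

Definition majority n (A : algebra n) (a b c : A) : A :=
  vee (vee (wedge a b) (wedge b c)) (wedge a c).

Lemma hom_majority n (A B : algebra n) (h : A -> B) a b c :
  is_hom h -> h (majority a b c) = majority (h a) (h b) (h c).
Proof. by move=> H; rewrite /majority !(hom_vee H) !(hom_wedge H). Qed.

Lemma majority_jelt n m (c : 'I_n.+1 -> 'I_m.+1) (x y : jalg c) :
  [/\ majority x x y = x, majority y x x = x & majority x y x = x].
Proof.
by split; apply: tle_ext => q qN; rewrite /majority /= !tle_prime // !tmeetP;
  case: (tle q x); case: (tle q y).
Qed.

Lemma alter_ego_duality n : yields_duality (V_ n) (@G_ n) (@S_ n).
Proof.
move=> A _ gamma gammaC gammaG gammaS.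
have [|l cover] := finite_cover gammaC.
  move=> [j x] [k y] homx homy.
  exact: (gamma_interp gammaG gammaS homx homy).
have [|p q Dp Dq|a Da] := @majority_interpolation _ _ (dualset (A := A))
    (* The dual set is built into the agreement sets because only homomorphisms commute with the
       majority term. *)
    (fun a => dualset (A := A) `&` agrees gamma a) (@majority n A) l (ctop A).
- move=> a b c [k x] agr.
  have homx : @is_hom n A (M k) x by case: agr => [[]|] [[]].
  split=> //; rewrite /agrees /= (@hom_majority n A (M k) _ _ _ _ homx).
  case: agr => [[[[_ ga] [_ gb]]|[[_ gb] [_ gc]]]|[[_ ga] [_ gc]]];
    [move: ga gb | move: gb gc | move: ga gc]; rewrite /agrees /= => g1 g2.
  + have [m1 _ _] := majority_jelt (gamma k x : M k) (x c).
    by rewrite -g1 -g2; exact: esym m1.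
  + have [_ m2 _] := majority_jelt (gamma k x : M k) (x a).
    by rewrite -g1 -g2; exact: esym m2.
  + have [_ _ m3] := majority_jelt (gamma k x : M k) (x b).
    by rewrite -g1 -g2; exact: esym m3.
- by have [a al [ap aq]] := cover p q Dp Dq; exists a.
- by exists a => k x homx; have [_] := Da (existT _ k x) homx.
Qed.

(** * Optimality *)

Section NonEvaluations.
Variables (n : nat) (A : algebra n).

(** [f_(i-1)] and [f_i] have distinct values in M_i. *)
Lemma no_hom_to_sort (i : 'I_n.+1) (j k : 'I_n.+1) (x : A -> Msort i) :
  (0 < i)%N -> i != j -> i != k -> @is_hom n A (M i) x ->
  (forall u v : 'I_n.+1, ((u < j)%N = (v < j)%N) -> ((u < k)%N = (v < k)%N) ->
     cf A u = cf A v) -> False.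
Proof.
move=> i_gt0 ij ik homx eqcf.
have lt_i1 : (i.-1 < n.+1)%N.
  exact: leq_ltn_trans (leq_pred _) (ltn_ord i).
have lt_pred : (i.-1 < i)%N by rewrite prednK.
have := congr1 x (eqcf (Ordinal lt_i1) i _ _).
rewrite !(hom_f homx) /= ltnn lt_pred => E.
have pred_lt (l : 'I_n.+1) : i != l -> (i.-1 < l)%N = (i < l)%N.
  by move=> il; rewrite prednK // [RHS]ltn_neqAle il.
by case: (E (pred_lt _ ij) (pred_lt _ ik)); rewrite i_gt0.
Qed.

(** A map depending only on the sort of [x] and on [x a0] is locally constant, whatever [phi]; all
    the counterexamples below have this form. *)
Lemma continuous_coord (phi : forall k : 'I_n.+1, Msort k -> Msort k) (a0 : A) :
  {within dualset (A := A),
    continuous (msmap (fun k (x : A -> Msort k) => phi k (x a0)))}.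
Proof.
apply: continuous_subspaceT.
have ck (k : 'I_n.+1) : continuous (fun x : {ptws A -> Msort k} =>
    existT (fun k : 'I_n.+1 => Msort k) k (phi k (x a0))).
  move=> f W nW; have nf : nbhs (f : {ptws A -> Msort k}) [set g | g a0 = f a0].
    exact: near_coord.
  have Ff := nbhs_filter (f : {ptws A -> Msort k}).
  apply: (@filterS _ _ Ff _ _ _ nf) => g /= ->.
  exact: nbhs_singleton nW.
by move=> [k f] W nW; exact: (ck k f W nW).
Qed.

End NonEvaluations.

Lemma M_in_V n (k : 'I_n.+1) : V_ n (M k).
Proof.
apply: ISP_M_sub_HSP_J; exists (prod_algebra (fun _ : unit => M k)).
  by exists unit, (fun=> M k); split=> // _; exists k.
exists (fun a _ => a); split; first by split.
by move=> a b /(congr1 (fun f => f tt)).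
Qed.

Lemma subalgebra_pair_in_V n (j k : 'I_n.+1)
    (R : set (pair_algebra (M j) (M k))) (subR : is_subuniverse R) :
  V_ n (subalgebra subR).
Proof.
pose B (b : bool) := M (if b then j else k).
apply: ISP_M_sub_HSP_J; exists (prod_algebra B).
  by exists bool, B; split=> // b; exists (if b then j else k).
exists (fun a b => match b as b return B b with
  | true => (proj1_sig a).1 | false => (proj1_sig a).2 end); split.
  by split=> *; apply: functional_extensionality_dep => -[].
move=> a b ab; apply: subalgebra_inj.
have := congr1 (fun f => f true) ab; have := congr1 (fun f => f false) ab.
by rewrite /=; case: (proj1_sig a) (proj1_sig b) => a1 a2 [b1 b2] /= -> ->.
Qed.

Lemma Jf_ord0_max m : (0 < m)%N -> Jf (ord0 : 'I_m.+1) <> Jf ord_max.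
Proof. by move=> m_gt0 [] /= m0; rewrite -m0 in m_gt0. Qed.

Lemma le_six_Jf_refl m p : @le_six m p (Jf ord0, Jf ord0).
Proof. by left; left; left; right. Qed.

Lemma le_six_Jmax_refl m p : @le_six m p (Jf ord_max, Jf ord_max).
Proof. by do 5!left; right. Qed.

Lemma le_six_0max m p : (0 < m)%N -> (0 < p)%N ->
  ~ @le_six m p (Jf ord0, Jf ord_max).
Proof.
by case: m p => [|m] [|p] // _ _; rewrite /le_six /=; do 7?[case]; case.
Qed.

Lemma sort_neq0 n (i : 'I_n.+1) : (0 < i)%N -> (i == ord0) = false.
Proof. by rewrite -val_eqE /= eqn0Ngt => ->. Qed.

(** * A non-evaluation for each removed operation or relation *)

Lemma drop_g n (k : 'I_n.+1) : (0 < k)%N ->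
  ~ yields_duality (V_ n) (@G_ n `\ g_op k) (@S_ n).
Proof.
move=> k_gt0 dual.
(* Constant on each sort: t on M_0 and the bold zero elsewhere. Constant pairs (t, t) and (0, 0)
   respect every relation, and M_k admits homomorphisms only to M_k and M_0. *)
pose phi (i : 'I_n.+1) (_ : Msort i) : Msort i :=
  if i == ord0 then Jt ord0 else Jf ord0.
have := dual (M k) (M_in_V k) (fun i x => phi i (x Top))
  (@continuous_coord n (M k) phi Top).
case=> [r0 [[i i_gt0 <-] nik] x homx|r|a ev].
- exfalso; have neq_ik : i != k by apply/eqP => ik; apply: nik; rewrite ik.
  apply: (no_hom_to_sort i_gt0 neq_ik neq_ik homx) => u v uv _.
  by rewrite /= uv.
- case=> [[->|[i i_gt0 <-]]|[i [j [i_gt0 ij ->]]]] x y _ _ _ /=;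
    rewrite /phi /=.
  + exact/le_fourE.
  + by rewrite sort_neq0 //; exact: le_six_Jf_refl.
  + by rewrite !sort_neq0 // ?(ltn_trans i_gt0 ij) //; exact: le_six_Jf_refl.
have homid : @is_hom n (M k) (M k) id by [].
have Gk : @G_ n (g_op k) by exists k.
(* The identity forces [a] to be the bold zero, which g_k sends to f and not to t. *)
have := ev ord0 _ (G_hom Gk); rewrite -[a](ev k id homid) /phi /= sort_neq0 //.
Qed.

Lemma drop_le_zero n :
  ~ yields_duality (V_ n) (@G_ n) (@S_ n `\ le_zero n).
Proof.
move=> dual; have S0 : @S_ n (le_zero n) by left; left.
have subR := S_subuniverse S0; pose A := subalgebra subR.
(* At (Bot, Top) the two projections receive Top and Bot, a pair outside [le_four]. Only M_0
   receives homomorphisms from [A], so nothing else constrains the map. *)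
pose phi (i : 'I_n.+1) (z : Msort i) : Msort i := if z == Bot then Top else Bot.
have a0P : @le_four (Bot, Top) by apply/le_fourE.
pose a0 : A := exist _ (Bot, Top) a0P.
have no_hom (i : 'I_n.+1) (x : A -> Msort i) :
    (0 < i)%N -> ~ @is_hom n A (M i) x.
  move=> i_gt0 homx; have i0 : i != ord0 by rewrite -val_eqE /= -lt0n.
  by apply: (no_hom_to_sort i_gt0 i0 i0 homx) => u v _ _; exact: subalgebra_inj.
have := dual A (subalgebra_pair_in_V subR) (fun i x => phi i (x a0))
  (@continuous_coord n A phi a0).
case=> [r0 [i i_gt0 <-] x homx|r [rS nr]|a ev].
- by case: (no_hom i x i_gt0).
- case: rS nr => [[->|[i i_gt0 <-]]|[i [j [i_gt0 ij ->]]]] nr x y homx homy.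
  + by case: nr.
  + by case: (no_hom i x i_gt0).
  + by case: (no_hom i x i_gt0).
have ev1 := ev ord0 (fun a => (proj1_sig a).1) _.
have ev2 := ev ord0 (fun a => (proj1_sig a).2) _.
have := proj2_sig a; move: ev1 ev2; rewrite /phi /=.
case: (proj1_sig a) => u v /= <- // <- //.
by move/le_fourE.
Qed.

Lemma drop_le_sort n (k : 'I_n.+1) : (0 < k)%N ->
  ~ yields_duality (V_ n) (@G_ n) (@S_ n `\ le_sort k).
Proof.
move=> k_gt0 dual; have Sk : @S_ n (le_sort k) by left; right; exists k.
have subR := S_subuniverse Sk; pose A := subalgebra subR.
(* On M_k this exchanges f and the bold zero, so at (f, 0) the projections receive (0, f), outside
   [le_six]. Both values lie over f, the value chosen on M_0, so g_k is still preserved. *)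
pose phi (i : 'I_n.+1) (z : Msort i) : Msort i :=
  if i == ord0 then Jf ord0
  else if z == Jf ord_max then Jf ord0 else Jf ord_max.
have a0P : @le_six (0 < k)%N (0 < k)%N (Jf ord_max, Jf ord0).
  by do 4!left; right.
pose a0 : A := exist _ (Jf ord_max, Jf ord0) a0P.
have no_hom (i : 'I_n.+1) (x : A -> Msort i) :
    (0 < i)%N -> i != k -> ~ @is_hom n A (M i) x.
  move=> i_gt0 ik homx.
  apply: (no_hom_to_sort i_gt0 ik ik homx) => u v uv _.
  by apply: subalgebra_inj; rewrite /= uv.
have := dual A (subalgebra_pair_in_V subR) (fun i x => phi i (x a0))
  (@continuous_coord n A phi a0).
case=> [r0 [i i_gt0 <-] x homx|r [rS nr]|a ev].
- by rewrite /phi /= sort_neq0 //; case: ifP.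
- case: rS nr => [[->|[i i_gt0 <-]]|[i [j [i_gt0 ij ->]]]] nr x y homx homy _.
  + exact/le_fourE.
  + by case: (no_hom i x i_gt0) => //; apply/eqP => ik; apply: nr; rewrite ik.
  + have [ik|ik] := eqVneq i k; last by case: (no_hom i x i_gt0).
    case: (no_hom j y (ltn_trans i_gt0 ij)) => //.
    by rewrite -ik eq_sym -val_eqE neq_ltn ij.
have ev1 := ev k (fun a => (proj1_sig a).1) _.
have ev2 := ev k (fun a => (proj1_sig a).2) _.
have := proj2_sig a; move: ev1 ev2; rewrite /phi /= sort_neq0 // eqxx.
have k1 : (0 < (0 < k)%N)%N by rewrite k_gt0.
have /eqP/negPf -> := Jf_ord0_max k1.
case: (proj1_sig a) => u v /= <- // <- //.
by apply: le_six_0max; rewrite k_gt0.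
Qed.

Lemma drop_le_sorts n (j k : 'I_n.+1) : (0 < j)%N -> (j < k)%N ->
  ~ yields_duality (V_ n) (@G_ n) (@S_ n `\ le_sorts j k).
Proof.
move=> j_gt0 jk dual; have Sjk : @S_ n (le_sorts j k) by right; exists j, k.
have k_gt0 := ltn_trans j_gt0 jk.
have kj : k != j by rewrite -val_eqE neq_ltn jk orbT.
have subR := S_subuniverse Sjk; pose A := subalgebra subR.
(* The bold zero on M_j and f on M_k; on M_0 [Jf ord0] is f. Each single sort sees a reflexive pair,
   while (0, f) violates [le_six] from M_j to M_k. *)
pose phi (i : 'I_n.+1) (_ : Msort i) : Msort i :=
  if (i == j) || (i == ord0) then Jf ord0 else Jf ord_max.
pose a0 := ctop A.
have no_hom (i : 'I_n.+1) (x : A -> Msort i) :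
    (0 < i)%N -> i != j -> i != k -> ~ @is_hom n A (M i) x.
  move=> i_gt0 ij ik homx.
  apply: (no_hom_to_sort i_gt0 ij ik homx) => u v uvj uvk.
  by apply: subalgebra_inj; rewrite /= uvj uvk.
have phi_le (i : 'I_n.+1) z : @le_six (0 < i)%N (0 < i)%N (phi i z, phi i z).
  rewrite /phi; case: ifP => _; first exact: le_six_Jf_refl.
  exact: le_six_Jmax_refl.
have := dual A (subalgebra_pair_in_V subR) (fun i x => phi i (x a0))
  (@continuous_coord n A phi a0).
case=> [r0 [i i_gt0 <-] x homx|r [rS nr]|a ev].
- by rewrite /phi /= eqxx orbT; case: ifP.
- case: rS nr => [[->|[i i_gt0 <-]]|[i [l [i_gt0 il ->]]]] nr x y homx homy _.
  + by apply/le_fourE; rewrite /phi /= eqxx orbT.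
  + exact: phi_le.
  + exfalso; have l_gt0 := ltn_trans i_gt0 il.
    have {}no_hom (q : 'I_n.+1) (z : A -> Msort q) :
        (0 < q)%N -> @is_hom n A (M q) z -> q = j \/ q = k.
      move=> q_gt0 homz; have [|qj] := eqVneq q j; first by left.
      by have [|qk] := eqVneq q k; [right|case: (no_hom q z)].
    case: (no_hom i x i_gt0 homx) (no_hom l y l_gt0 homy) => ei [] el.
    * by rewrite ei el ltnn in il.
    * by apply: nr; rewrite ei el.
    * by rewrite ei el ltnNge ltnW in il.
    * by rewrite ei el ltnn in il.
have ev1 := ev j (fun a => (proj1_sig a).1) _.
have ev2 := ev k (fun a => (proj1_sig a).2) _.
have := proj2_sig a; move: ev1 ev2; rewrite /phi /= eqxx (negPf kj) /=.
rewrite sort_neq0 //.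
case: (proj1_sig a) => u v /= <- // <- //.
by apply: le_six_0max; rewrite ?k_gt0 ?j_gt0.
Qed.

Theorem theorem10p4 (n : nat) (n_gt0 : (0 < n)%N) :
  (forall A : algebra n,
     V_ n A <-> ISP (fun B : algebra n => exists k : 'I_n.+1, B = M k) A) /\
  optimal_duality (V_ n) (G_ n) (S_ n).
Proof.
split=> [A|]; first by split; [exact: HSP_J_sub_ISP_M|exact: ISP_M_sub_HSP_J].
split; first exact: alter_ego_duality.
- by move=> _ [k k_gt0 <-]; exact: drop_g.
- move=> r [[->|[k k_gt0 <-]]|[j [k [j_gt0 jk ->]]]].
  + exact: drop_le_zero.
  + exact: drop_le_sort.
  + exact: drop_le_sorts.
Qed.
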